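(* For a positive integer $N$, let $[N]=\{1,2,\dots,N\}$. A $3$-AP in $[N]$ is a triple $(a,a+d,a+2d)$ with all three terms in $[N]$, where $d$ is any integer (zero and negative values allowed); let $\mathrm{AP}_3(N)$ denote the total number of $3$-APs in $[N]$. For a $2$-coloring $c$ of $[N]$ (each integer colored red or blue), let $m_3(c)$ be the number of $3$-APs in $[N]$ all of whose terms receive the same color. Let $\tilde{\mathcal{C}}_2(N)$ be the set of $2$-colorings of $[N]$ that are anti-symmetric and have at most $12$ maximal contiguous blocks of a single color, and let \[\tilde P(N)=\min_{c\in\tilde{\mathcal{C}}_2(N)}\frac{m_3(c)}{\mathrm{AP}_3(N)}.\] Then $\lim_{N\to\infty}\tilde P(N)=\frac{117}{548}$.
   Context: A coloring of $[N]$ is anti-symmetric if its left half is the mirror image of its right half with the colors swapped, i.e. $i$ and $N+1-i$ receive opposite colors (for every $i$ with $i\neq N+1-i$). A block is a maximal run of consecutive integers of the same color. *)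

(* Defs.v *)
From HB Require Import structures.
From mathcomp Require Import all_boot all_order all_algebra.
From mathcomp Require Import all_classical all_reals all_analysis.
From mathcomp Require Import zify.

Set Implicit Arguments.
Unset Strict Implicit.
Unset Printing Implicit Defensive.

Import Order.TTheory GRing.Theory Num.Theory.
Import numFieldNormedType.Exports.

Local Open Scope ring_scope.

(* Throughout, the ordinal [i : 'I_N] stands for the integer [i.+1] of
   [N] = {1, ..., N}, so [rev_ord] is the reflection i |-> N + 1 - i. *)

Definition coloring (N : nat) := {ffun 'I_N -> bool}.

Definition is_ap3 N (x y z : 'I_N) : Prop :=
  exists d : int, y.+1%:Z = x.+1%:Z + d /\ z.+1%:Z = x.+1%:Z + 2 * d.

(* A triple determines its difference d, so counting triples is the same as
   counting pairs (a, d). *)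
Definition ap3 (N : nat) : {set 'I_N * 'I_N * 'I_N} :=
  [set t | `[< is_ap3 t.1.1 t.1.2 t.2 >]].

Definition m3 N (c : coloring N) : nat :=
  #|[set t in ap3 N | (c t.1.1 == c t.1.2) && (c t.1.2 == c t.2)]|.

Definition anti_symmetric N (c : coloring N) : bool :=
  [forall i, (i != rev_ord i) ==> (c (rev_ord i) != c i)].

Definition monochromatic_run N (c : coloring N) (B : {set 'I_N}) : bool :=
  [&& B != finset.set0,
      [forall i in B, forall k in B, forall j : 'I_N,
         (i <= j <= k)%N ==> (j \in B)]
    & [forall i in B, forall j in B, c i == c j]].

Definition blocks N (c : coloring N) : {set {set 'I_N}} :=
  [set B | maxset (monochromatic_run c) B].

Definition Ctilde2 (N : nat) : {set coloring N} :=
  [set c | anti_symmetric c && (#|blocks c| <= 12)%N].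

Definition mono_ratio (R : realType) N (c : coloring N) : R :=
  (m3 c)%:R / #|ap3 N|%:R.

(* Ratios are at most 1 and [Ctilde2 N] is never empty, so the default value 1
   plays no role: see [Ptilde_is_min]. *)
Definition Ptilde (R : realType) (N : nat) : R :=
  \big[Num.min/1]_(c in Ctilde2 N) mono_ratio R c.

Lemma mono_ratio_le1 (R : realType) N (c : coloring N) : mono_ratio R c <= 1.
Proof.
rewrite /mono_ratio; have [->|n0] := eqVneq #|ap3 N| 0%N.
  by rewrite invr0 mulr0 ler01.
rewrite ler_pdivrMr ?ltr0n ?lt0n// mul1r ler_nat; apply: subset_leq_card.
by apply/fintype.subsetP => t; rewrite inE => /andP[].
Qed.

Lemma Ctilde2_nonempty N : exists c, c \in Ctilde2 N.
Proof.
pose c : coloring N := [ffun i : 'I_N => (i < N./2)%N].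
exists c; rewrite inE; apply/andP; split.
  apply/forallP => i; apply/implyP => ni; rewrite !ffunE /=.
  have := ltn_ord i; move: ni; rewrite -val_eqE /= => ni iN.
  have hN := odd_double_half N.
  case: ltnP; case: ltnP => //; move: hN; rewrite -addnn; move/eqP: ni;
    case: (odd N) => /=; lia.
pose S b := [set i | c i == b].
have runS i : monochromatic_run c (S (c i)).
  apply/and3P; split.
  - by apply/set0Pn; exists i; rewrite inE.
  - apply/forall_inP => a; rewrite inE => /eqP ca.
    apply/forall_inP => b; rewrite inE => /eqP cb.
    apply/forallP => j; apply/implyP => /andP[aj jb]; rewrite inE.
    move: ca cb; rewrite /c !ffunE => <- /eqP; move: aj jb.
    by do 3 case: ltnP => //=; lia.
  - apply/forall_inP => a; rewrite inE => /eqP ->.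
    by apply/forall_inP => b; rewrite inE => /eqP ->.
suff /subset_leq_card/leq_trans : blocks c \subset [set S true; S false].
  by apply; rewrite cards2; case: (_ != _).
apply/fintype.subsetP => B; rewrite inE => /maxsetP[/and3P[/set0Pn[i iB] _ mB] maxB].
have BS : B \subset S (c i).
  apply/fintype.subsetP => j jB; rewrite inE.
  by move/forall_inP : mB => /(_ j jB)/forall_inP/(_ i iB).
by rewrite -(maxB _ (runS i) BS) !inE; case: (c i); rewrite eqxx ?orbT.
Qed.

Lemma Ptilde_is_min (R : realType) N :
  (exists2 c, c \in Ctilde2 N & Ptilde R N = mono_ratio R c) /\
  (forall c, c \in Ctilde2 N -> Ptilde R N <= mono_ratio R c).
Proof.
split; last by move=> c cC; apply: bigmin_le_cond.
have [c0 c0C] := Ctilde2_nonempty N.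
have [c cC e] := @eq_bigmin _ R _ 1 c0 (mem (Ctilde2 N)) (mono_ratio R (N := N))
  c0C (fun c _ => mono_ratio_le1 R c).
by exists c.
Qed.

(* Main.v *)
(* With signs s = 1, -1 for the colors, four times the number of monochromatic
   3-APs is AP_3(N) + 2 T + X, where T is the sum of s_x s_y over the 3-APs
   (x, y, z) and X, the sum of s_x s_z, is half a sum of two squares and O(1).  For
   an anti-symmetric coloring T is, up to O(N), N^2/2 times the energy
     J = int int g(x) g(y) dx dy over (1 - x)/2 < y < (1 + x)/2
   of the step function g : [0, 1] -> {1, -1} of its right half, which has
   breakpoints t_1 <= ... <= t_5.  Since AP_3(N) ~ N^2/2, the limit is
   (1 + 2 min J)/4, and it remains to see that min J = -10/137.

   A minimizer exists by compactness.  Coinciding breakpoints cancel and can be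
   moved to 0, so there is a minimizer at which the gradient vanishes.  With
   G(x) = int_0^|x| g this means
     G((1 + t_i)/2) - G((1 - t_i)/2) + G(1) - G(2 t_i - 1) = 0,
   and by homogeneity J becomes a linear expression in values of G.  As G is even,
   1-Lipschitz and of slope 1, -1 between breakpoints, each relative order of the
   points (1 +- t_i)/2, |2 t_i - 1| and t_j leaves a linear program, and the bound
   J >= -10/137 follows from finitely many Farkas certificates.  Equality holds at
   t = (116, 175, 212, 240, 246)/274. *)

(* The region of J comes from folding. With the origin at the centre and half-length 1, a 3-AP
   starting with x, y stays in range when |2y - x| < 1. In terms of absolute values this is y < (1 +
   x)/2 if x and y lie in the same half and y < (1 - x)/2 if they lie in opposite halves; the latter
   pairs count negatively, so only the band between remains. Twelve blocks leave five breakpoints,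
   as the centre carries one change and the others come in mirror pairs. J itself is piecewise
   quadratic; stationarity is what makes it linear. The values of G at 1/2 and (1 +- t_i)/2 can then
   be free variables tied only by Lipschitz bounds: G is known at every t_j, and between adjacent
   t_j the bounds to both neighbours force its value, so nothing is lost. The obstacle is a
   minimizer on the boundary of t_1 <= ... <= t_5, where a derivative need not vanish. The point 0
   is a safe place for spare breakpoints, since there the derivative vanishes by evenness of G. *)
Require Import Defs.
From Stdlib Require Import BinInt BinNat.
From mathcomp Require Import all_boot all_order all_algebra.
From mathcomp Require Import all_classical all_reals all_analysis.
From mathcomp Require Import zify ssrZ ring lra.

Set Implicit Arguments.
Unset Strict Implicit.
Unset Printing Implicit Defensive.

Import Order.TTheory GRing.Theory Num.Theory.
Import numFieldNormedType.Exports.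

Local Open Scope classical_set_scope.
Local Open Scope ring_scope.

(** * Certified case analysis for Lipschitz data *)

(* [[:: z0; z1; ..]] stands for the affine form z0 + z1 x1 + ...; the value of
   the first variable is taken to be 1. *)
Definition form := seq Z.

Fixpoint addf (f g : form) : form :=
  match f, g with
  | [::], _ => g
  | _, [::] => f
  | a :: f', b :: g' => Z.add a b :: addf f' g'
  end.

Definition scalef (k : Z) (f : form) : form := [seq Z.mul k z | z <- f].

Definition subf (f g : form) : form := addf f (scalef (Zneg xH) g).

(* A branch [Split p q t u] compares the positions of points [p] and [q];
   [Cut p q l t] certifies that [p] lies before [q]. *)
Inductive tree :=
  | Leaf (k : N) (l : seq (N * N))
  | Cut (p q : N) (l : seq (N * N)) (t : tree)
  | Split (p q : N) (t u : tree).

Definition comb (ctx : seq form) (l : seq (N * N)) : form :=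
  foldr (fun ik f => addf (scalef (Z.of_N ik.2) (nth [::] ctx (N.to_nat ik.1))) f)
    [::] l.

(* Farkas certificate for 0 <= b * goal + a; the case [k = 0] certifies that the
   context is contradictory. *)
Definition certifies (ctx : seq form) (goal : form) (a b : Z)
    (k : N) (l : seq (N * N)) : bool :=
  let r := subf (scalef (Z.of_N k) goal) (comb ctx l) in
  let s := Z.add (Z.mul b (head Z0 r)) (Z.mul (Z.of_N k) a) in
  [&& all (Z.eqb Z0) (behead r), Z.leb Z0 s & (N.ltb N0 k || Z.ltb Z0 s)].

Definition ptn (pts : seq (form * form)) (p : N) := nth ([::], [::]) pts (N.to_nat p).

(** A point is a pair of a position and a value. Once [p] is known to lie before [q], the Lipschitz
    condition is two linear inequalities; their sum also records the order. *)
Definition lipf (p q : form * form) : seq form :=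
  let d := subf q.1 p.1 in let v := subf q.2 p.2 in [:: addf d v; subf d v].

Fixpoint check (pts : seq (form * form)) (goal : form) (a b : Z)
    (ctx : seq form) (t : tree) : bool :=
  match t with
  | Leaf k l => certifies ctx goal a b k l
  | Cut p q l t' =>
      certifies ctx (subf (ptn pts q).1 (ptn pts p).1) Z0 (Zpos xH) (Npos xH) l &&
      check pts goal a b (ctx ++ lipf (ptn pts p) (ptn pts q)) t'
  | Split p q t' u' =>
      check pts goal a b (ctx ++ lipf (ptn pts p) (ptn pts q)) t' &&
      check pts goal a b (ctx ++ lipf (ptn pts q) (ptn pts p)) u'
  end.

Section CheckSound.
Variable R : realFieldType.

Definition zR (z : Z) : R := (int_of_Z z)%:~R.

Fixpoint evalf (e : seq R) (f : form) {struct f} : R :=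
  match f, e with
  | z :: f', x :: e' => zR z * x + evalf e' f'
  | _, _ => 0
  end.

Lemma zRD x y : zR (Z.add x y) = zR x + zR y.
Proof. by rewrite /zR (rmorphD int_of_Z x y) rmorphD. Qed.

Lemma zRM x y : zR (Z.mul x y) = zR x * zR y.
Proof. by rewrite /zR (rmorphM int_of_Z x y) rmorphM. Qed.

Lemma zR0 : zR Z0 = 0. Proof. by []. Qed.

Lemma zR_ge0 z : Z.leb Z0 z -> 0 <= zR z.
Proof. by case: z => // p _; rewrite /zR /= ler0z. Qed.

Lemma zR_gt0 z : Z.ltb Z0 z -> 0 < zR z.
Proof. by case: z => // p _; rewrite /zR /= ltr0z; lia. Qed.

Lemma evalf_add e f g : evalf e (addf f g) = evalf e f + evalf e g.
Proof.
elim: f e g => [|a f IH] e g; first by rewrite /= add0r.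
case: g => [|b g]; first by rewrite /= addr0.
by case: e => [|x e] /=; rewrite ?addr0 // IH zRD mulrDl addrACA.
Qed.

Lemma evalf_scale e k f : evalf e (scalef k f) = zR k * evalf e f.
Proof.
elim: f e => [|a f IH] e /=; first by rewrite mulr0.
by case: e => [|x e]; rewrite ?mulr0 // IH zRM mulrDr mulrA.
Qed.

Lemma evalf_sub e f g : evalf e (subf f g) = evalf e f - evalf e g.
Proof. by rewrite evalf_add evalf_scale (_ : zR _ = -1) // mulN1r. Qed.

Lemma comb_ge0 e ctx l : (forall f, f \in ctx -> 0 <= evalf e f) ->
  0 <= evalf e (comb ctx l).
Proof.
move=> ctx0; elim: l => //= -[i k] l IH; rewrite evalf_add evalf_scale addr_ge0//=.
apply: mulr_ge0; first by case: k => // p; rewrite /zR /= ler0z.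
have [ilt|ige] := ltnP (N.to_nat i) (size ctx); first exact/ctx0/mem_nth.
(* An index out of range selects the empty form, whose value is 0. *)
by rewrite nth_default.
Qed.

(** Here [k * goal] exceeds the combination by a constant r, so k (b goal + a) is b r + k a plus b
    times the combination. For k = 0 the left side is 0 and the right side is positive, a
    contradiction. *)
Lemma certifies_sound e ctx goal a b k l :
  (forall f, f \in ctx -> 0 <= evalf (1 :: e) f) -> Z.ltb Z0 b ->
  certifies ctx goal a b k l -> 0 <= zR b * evalf (1 :: e) goal + zR a.
Proof.
move=> ctx0 b0 /and3P[]; set r := subf _ _ => /= rtl s0 ks.
have rE : evalf (1 :: e) r = zR (head Z0 r).
  case: (r) rtl => [//|z r'] /= r'0; rewrite mulr1 [X in _ + X](_ : _ = 0) ?addr0//.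
  elim: r' e r'0 {ctx0} => //= y r' IH [//|x e] /andP[y0 r'0].
  by rewrite IH// addr0 -(Z.eqb_eq Z0 y).1 // mul0r.
have := comb_ge0 l ctx0.
move: rE; rewrite evalf_sub evalf_scale => /eqP; rewrite subr_eq => /eqP rE c0.
have hb := zR_gt0 b0; have hs := zR_ge0 s0.
have kE : zR (Z.of_N k) * (zR b * evalf (1 :: e) goal + zR a) =
    zR (Z.add (Z.mul b (head Z0 r)) (Z.mul (Z.of_N k) a))
    + zR b * evalf (1 :: e) (comb ctx l).
  by rewrite zRD !zRM mulrDr mulrCA rE; ring.
have [k0|k0] := boolP (N.ltb N0 k); last first.
  have kz : k = N0 by case: (k) k0.
  move: ks kE; rewrite kz /= => /zR_gt0 s1 kE.
  have := mulr_ge0 (ltW hb) c0; rewrite [zR (Z.of_N 0)]zR0 mul0r in kE.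
  by rewrite kz /= in hs kE *; lra.
have hk : 0 < zR (Z.of_N k) by apply: zR_gt0; case: (k) k0.
by rewrite -(pmulr_rge0 _ hk) kE addr_ge0 // mulr_ge0 // ltW.
Qed.

(* The values at the points are those of a 1-Lipschitz function, so that in each
   branch of a comparison the difference of values is bounded linearly. *)
Lemma check_sound e (G : R -> R) pts goal a b ctx t : Z.ltb Z0 b ->
  (forall x y, `|G y - G x| <= `|y - x|) -> G 0 = 0 ->
  (forall p, p \in pts -> evalf (1 :: e) p.2 = G (evalf (1 :: e) p.1)) ->
  (forall f, f \in ctx -> 0 <= evalf (1 :: e) f) ->
  check pts goal a b ctx t -> 0 <= zR b * evalf (1 :: e) goal + zR a.
Proof.
move=> b0 lipG G0 ptsG.
have ptG p : evalf (1 :: e) (ptn pts p).2 = G (evalf (1 :: e) (ptn pts p).1).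
  have [pl|pl] := ltnP (N.to_nat p) (size pts); first exact/ptsG/mem_nth.
  (* A point index out of range denotes position 0 with value 0, which is correct because
     [G 0 = 0]. *)
  by rewrite /ptn nth_default.
have lipP p q ctx' : (forall f, f \in ctx' -> 0 <= evalf (1 :: e) f) ->
    evalf (1 :: e) (ptn pts p).1 <= evalf (1 :: e) (ptn pts q).1 ->
    forall f, f \in ctx' ++ lipf (ptn pts p) (ptn pts q) -> 0 <= evalf (1 :: e) f.
  move=> ctx0 pq f; rewrite mem_cat => /orP[/ctx0//|].
  have := lipG (evalf (1 :: e) (ptn pts p).1) (evalf (1 :: e) (ptn pts q).1).
  rewrite [X in _ <= X]ger0_norm ?subr_ge0 // ler_norml => /andP[lo hi].
  rewrite !inE => /orP[] /eqP ->.
    by rewrite evalf_add !evalf_sub !ptG; lra.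
  by rewrite !evalf_sub !ptG; lra.
elim: t ctx => [k l|p q l t IH|p q t IHt u IHu] ctx ctx0 /=.
- exact: certifies_sound.
- move=> /andP[c]; apply: IH; apply: lipP => //.
  have := certifies_sound ctx0 (erefl _ : Z.ltb Z0 (Zpos xH)) c.
  by rewrite zR0 addr0 evalf_sub /zR /= mul1r subr_ge0.
- move=> /andP[ct cu].
  have [pq|qp] := leP (evalf (1 :: e) (ptn pts p).1) (evalf (1 :: e) (ptn pts q).1).
    by apply: IHt ct; apply: lipP.
  by apply: IHu cu; apply: lipP => //; exact: ltW.
Qed.

End CheckSound.

(** * Linear programs for critical points and their certificates *)

Local Open Scope Z_scope.

(* The variables are t_1, .., t_5, G(1/2), G((1 + t_i)/2), G((1 - t_i)/2).  The
   points are 0, t_i, 1, 1/2, (1 + t_i)/2, (1 - t_i)/2, 2 t_i - 1, 1 - 2 t_i, each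
   listed as twice its position and twice the value of G there; at the last ten
   points that value comes from the criticality equations. *)
Definition crit_points : seq (form * form) :=
  [:: ([::], [::]);
      ([:: 0; 2], [:: 0; 2]);
      ([:: 0; 0; 2], [:: 0; 4; (-2)]);
      ([:: 0; 0; 0; 2], [:: 0; 4; (-4); 2]);
      ([:: 0; 0; 0; 0; 2], [:: 0; 4; (-4); 4; (-2)]);
      ([:: 0; 0; 0; 0; 0; 2], [:: 0; 4; (-4); 4; (-4); 2]);
      ([:: 2], [:: (-2); 4; (-4); 4; (-4); 4]);
      ([:: 1], [:: 0; 0; 0; 0; 0; 0; 2]);
      ([:: 1; 1], [:: 0; 0; 0; 0; 0; 0; 0; 2]);
      ([:: 1; 0; 1], [:: 0; 0; 0; 0; 0; 0; 0; 0; 2]);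
      ([:: 1; 0; 0; 1], [:: 0; 0; 0; 0; 0; 0; 0; 0; 0; 2]);
      ([:: 1; 0; 0; 0; 1], [:: 0; 0; 0; 0; 0; 0; 0; 0; 0; 0; 2]);
      ([:: 1; 0; 0; 0; 0; 1], [:: 0; 0; 0; 0; 0; 0; 0; 0; 0; 0; 0; 2]);
      ([:: 1; (-1)], [:: 0; 0; 0; 0; 0; 0; 0; 0; 0; 0; 0; 0; 2]);
      ([:: 1; 0; (-1)], [:: 0; 0; 0; 0; 0; 0; 0; 0; 0; 0; 0; 0; 0; 2]);
      ([:: 1; 0; 0; (-1)], [:: 0; 0; 0; 0; 0; 0; 0; 0; 0; 0; 0; 0; 0; 0; 2]);
      ([:: 1; 0; 0; 0; (-1)], [:: 0; 0; 0; 0; 0; 0; 0; 0; 0; 0; 0; 0; 0; 0; 0; 2]);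
      ([:: 1; 0; 0; 0; 0; (-1)], [:: 0; 0; 0; 0; 0; 0; 0; 0; 0; 0; 0; 0; 0; 0; 0; 0; 2]);
      ([:: (-2); 4], [:: (-2); 4; (-4); 4; (-4); 4; 0; 2; 0; 0; 0; 0; (-2)]);
      ([:: (-2); 0; 4], [:: (-2); 4; (-4); 4; (-4); 4; 0; 0; 2; 0; 0; 0; 0; (-2)]);
      ([:: (-2); 0; 0; 4], [:: (-2); 4; (-4); 4; (-4); 4; 0; 0; 0; 2; 0; 0; 0; 0; (-2)]);
      ([:: (-2); 0; 0; 0; 4], [:: (-2); 4; (-4); 4; (-4); 4; 0; 0; 0; 0; 2; 0; 0; 0; 0; (-2)]);
      ([:: (-2); 0; 0; 0; 0; 4], [:: (-2); 4; (-4); 4; (-4); 4; 0; 0; 0; 0; 0; 2; 0; 0; 0; 0; (-2)]);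
      ([:: 2; (-4)], [:: (-2); 4; (-4); 4; (-4); 4; 0; 2; 0; 0; 0; 0; (-2)]);
      ([:: 2; 0; (-4)], [:: (-2); 4; (-4); 4; (-4); 4; 0; 0; 2; 0; 0; 0; 0; (-2)]);
      ([:: 2; 0; 0; (-4)], [:: (-2); 4; (-4); 4; (-4); 4; 0; 0; 0; 2; 0; 0; 0; 0; (-2)]);
      ([:: 2; 0; 0; 0; (-4)], [:: (-2); 4; (-4); 4; (-4); 4; 0; 0; 0; 0; 2; 0; 0; 0; 0; (-2)]);
      ([:: 2; 0; 0; 0; 0; (-4)], [:: (-2); 4; (-4); 4; (-4); 4; 0; 0; 0; 0; 0; 2; 0; 0; 0; 0; (-2)])].

Definition crit_order : seq form :=
  [:: [:: 0; 1];
      [:: 0; (-1); 1];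
      [:: 0; 0; (-1); 1];
      [:: 0; 0; 0; (-1); 1];
      [:: 0; 0; 0; 0; (-1); 1];
      [:: 1; 0; 0; 0; 0; (-1)]].

(** Euler's identity for J with all slopes zero: minus G(1), written out in the t_i, minus G(1/2),
    plus the alternating sum of the values at (1 +- t_i)/2. *)
Definition crit_energy : form :=
  [:: 1; (-2); 2; (-2); 2; (-2); (-1); 1; (-1); 1; (-1); 1; 1; (-1); 1; (-1); 1].

Local Close Scope Z_scope.

(** Comparisons that already follow from [crit_order], so they need no branching. Indices in the
    leaves of the tree count the forms of [crit_order], then two inequalities per cut, then two per
    split on the path. *)
Definition crit_cuts : seq (N * N * seq (N * N)) :=
  [:: (0,4,[:: (0,2); (1,2); (2,2); (3,2)]); (0,16,[:: (4,1); (5,1)]);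
(0,17,[:: (5,1)]); (1,8,[:: (1,1); (2,1); (3,1); (4,1); (5,1)]); (2,9,[::
(2,1); (3,1); (4,1); (5,1)]); (3,10,[:: (3,1); (4,1); (5,1)]); (4,11,[:: (4,1);
(5,1)]); (5,12,[:: (5,1)]); (7,8,[:: (0,1)]); (7,9,[:: (0,1); (1,1)]); (8,9,[::
(1,1)]); (8,11,[:: (1,1); (2,1); (3,1)]); (9,6,[:: (2,1); (3,1); (4,1);
(5,1)]); (9,10,[:: (2,1)]); (9,11,[:: (2,1); (3,1)]); (9,12,[:: (2,1); (3,1);
(4,1)]); (10,6,[:: (3,1); (4,1); (5,1)]); (10,11,[:: (3,1)]); (10,12,[:: (3,1);
(4,1)]); (11,6,[:: (4,1); (5,1)]); (11,12,[:: (4,1)]); (13,7,[:: (0,1)]);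
(13,8,[:: (0,2)]); (13,9,[:: (0,2); (1,1)]); (13,11,[:: (0,2); (1,1); (2,1);
(3,1)]); (14,7,[:: (0,1); (1,1)]); (14,13,[:: (1,1)]); (15,7,[:: (0,1); (1,1);
(2,1)]); (15,14,[:: (2,1)]); (16,7,[:: (0,1); (1,1); (2,1); (3,1)]); (16,13,[::
(1,1); (2,1); (3,1)]); (16,15,[:: (3,1)]); (17,13,[:: (1,1); (2,1); (3,1);
(4,1)]); (17,15,[:: (3,1); (4,1)]); (17,16,[:: (4,1)]); (18,19,[:: (1,4)]);
(19,20,[:: (2,4)]); (19,21,[:: (2,4); (3,4)]); (20,3,[:: (3,2); (4,2); (5,2)]);
(20,21,[:: (3,4)]); (20,22,[:: (3,4); (4,4)]); (21,22,[:: (4,4)]); (22,5,[::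
(5,2)]); (22,6,[:: (5,4)]); (22,12,[:: (5,3)]); (23,6,[:: (0,4)])]%num.

(* Found by branch and bound: each node splits on a pair of points at which the
   solution of the current linear program violates the Lipschitz condition. *)
Definition crit_tree : tree :=
((Split 1 13 (Split 2 7 (Split 4 22 (Split 3 21 (Split 2 20 (Leaf 28 [::
(10,6); (16,24); (19,26); (20,22); (27,14); (41,2); (49,2); (58,12); (63,2);
(101,12); (102,1); (103,9); (104,14); (107,12)]) (Split 3 8 (Leaf 4 [:: (11,1);
(19,4); (20,5); (32,2); (49,2); (63,2); (103,3); (104,2); (108,2)]) (Split 1 16
(Split 2 14 (Leaf 4 [:: (16,1); (19,4); (20,4); (32,2); (49,2); (63,1);
(103,2); (104,2); (106,1); (109,2); (113,1)]) (Leaf 24 [:: (10,2); (19,31);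
(20,22); (32,12); (39,7); (41,1); (49,8); (58,4); (63,4); (101,4); (103,10);
(104,20); (106,8); (109,12); (110,8); (112,4)])) (Split 1 15 (Leaf 40 [::
(11,3); (16,12); (19,55); (20,43); (32,20); (45,5); (49,6); (58,14); (63,6);
(101,14); (103,23); (104,30); (106,12); (109,20); (111,10); (112,2)]) (Leaf 4
[:: (16,1); (19,4); (20,4); (32,2); (58,2); (101,2); (103,2); (104,2); (106,1);
(109,2); (113,1)]))))) (Split 4 9 (Split 4 7 (Split 16 22 (Split 1 26 (Split 4
16 (Leaf 24 [:: (20,24); (27,12); (41,12); (49,6); (55,2); (58,4); (63,8);
(68,4); (96,1); (97,1); (103,14); (109,6); (110,2); (112,2); (115,4)]) (Split 3
17 (Leaf 24 [:: (20,16); (27,12); (41,12); (49,6); (55,2); (58,4); (63,8);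
(68,4); (96,1); (97,1); (103,4); (109,6); (112,2); (114,6); (116,8)]) (Split 4
14 (Leaf 4 [:: (20,3); (27,2); (41,2); (49,2); (68,2); (103,1); (117,1);
(119,2)]) (Split 3 15 (Leaf 4 [:: (20,4); (27,2); (41,2); (49,1); (55,1);
(68,1); (103,2); (109,1); (112,1); (118,2); (120,1)]) (Split 2 16 (Leaf 32 [::
(20,32); (27,16); (41,16); (49,8); (55,4); (58,4); (63,8); (96,1); (97,1);
(102,2); (103,18); (109,8); (112,4); (118,4); (121,8); (123,12)]) (Leaf 4 [::
(20,4); (27,2); (41,2); (49,1); (55,1); (63,2); (103,2); (109,1); (112,1);
(122,1)])))))) (Split 3 15 (Leaf 32 [:: (20,32); (27,16); (41,16); (44,2);
(55,4); (58,12); (63,4); (68,10); (103,16); (108,5); (109,21); (113,6);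
(114,2)]) (Split 5 23 (Split 2 16 (Leaf 16 [:: (20,16); (22,2); (27,4); (41,8);
(53,4); (55,2); (58,4); (63,4); (102,1); (103,9); (108,2); (109,8); (113,2);
(115,4); (116,2); (119,6)]) (Leaf 48 [:: (20,48); (22,6); (41,24); (53,24);
(55,10); (58,8); (63,16); (68,8); (102,1); (103,25); (108,17); (109,35);
(113,10); (116,18); (118,6)])) (Leaf 32 [:: (20,32); (27,14); (41,16); (44,2);
(53,2); (55,2); (58,12); (63,4); (68,12); (98,2); (103,16); (108,5); (109,21);
(113,4); (117,2)])))) (Leaf 4 [:: (20,3); (27,2); (41,2); (49,2); (63,2);
(75,1); (103,2); (111,1)])) (Split 1 21 (Split 3 8 (Split 1 24 (Split 3 13
(Split 2 16 (Split 3 15 (Leaf 4 [:: (20,4); (22,2); (35,1); (41,2); (58,2);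
(68,1); (103,2); (107,3); (110,1); (120,1)]) (Leaf 32 [:: (20,32); (22,16);
(35,2); (41,16); (44,3); (58,10); (63,6); (68,8); (103,16); (107,18); (110,5);
(116,6); (119,3); (121,2)])) (Leaf 4 [:: (20,4); (22,2); (35,1); (41,2);
(63,2); (103,2); (107,3); (110,1); (116,2); (118,1)])) (Split 2 14 (Leaf 100
[:: (11,25); (20,125); (22,50); (41,50); (44,12); (63,12); (68,38); (102,8);
(103,83); (105,2); (107,60); (110,10); (114,10); (117,50); (119,28)]) (Split 0
25 (Leaf 4 [:: (20,4); (22,2); (41,3); (68,1); (103,2); (107,3); (110,1);
(114,1); (117,2); (118,1); (121,1)]) (Leaf 4 [:: (20,4); (41,3); (49,2);
(68,1); (103,2); (107,3); (110,1); (112,2); (114,1); (118,1); (120,1)]))))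
(Leaf 4 [:: (11,1); (20,5); (41,2); (68,2); (98,2); (101,2); (103,3); (107,4);
(110,1); (111,1); (112,2); (115,2)])) (Split 2 14 (Leaf 132 [:: (10,18);
(20,114); (41,66); (44,6); (58,51); (63,6); (68,60); (96,15); (101,66);
(102,6); (103,54); (107,66); (110,6); (113,81); (114,1); (115,10)]) (Split 1 24
(Leaf 4 [:: (20,4); (41,3); (49,2); (68,1); (84,1); (103,2); (107,3); (113,2);
(114,1); (116,1)]) (Leaf 4 [:: (20,4); (41,3); (58,1); (68,1); (84,1); (98,1);
(101,2); (103,2); (107,3); (113,2); (117,1)])))) (Split 3 15 (Leaf 4 [::
(20,4); (27,1); (29,1); (41,2); (58,2); (68,1); (103,2); (107,1); (108,2);
(111,1); (112,1)]) (Split 1 15 (Split 5 23 (Split 2 16 (Leaf 32 [:: (20,32);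
(27,12); (41,16); (44,4); (49,12); (58,8); (63,8); (97,1); (103,16); (107,4);
(108,4); (111,4); (113,8); (116,3); (119,12)]) (Leaf 68 [:: (20,68); (27,15);
(29,9); (41,34); (44,4); (49,28); (58,16); (63,18); (68,16); (103,34);
(107,19); (108,6); (111,13); (116,10); (118,5)])) (Split 3 13 (Leaf 4 [::
(11,1); (20,5); (29,1); (41,2); (58,2); (68,1); (103,3); (107,2); (108,2);
(111,1); (114,1); (117,1); (118,1)]) (Split 0 25 (Leaf 60 [:: (11,9); (20,69);
(27,14); (29,8); (41,38); (44,4); (58,30); (68,10); (103,39); (107,16);
(108,30); (111,20); (114,12); (117,8); (119,8); (121,8)]) (Leaf 48 [:: (20,48);
(27,16); (29,4); (41,37); (44,2); (49,4); (58,24); (68,5); (101,13); (103,24);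
(107,8); (108,7); (111,19); (114,6); (117,4); (120,13)])))) (Leaf 12 [::
(11,5); (20,17); (27,6); (41,6); (44,4); (58,6); (68,2); (101,2); (103,11);
(108,4); (111,4); (115,4)]))))) (Split 2 20 (Leaf 28 [:: (10,6); (20,22);
(22,2); (27,12); (41,27); (58,14); (68,1); (101,12); (102,2); (103,10);
(105,13); (106,2); (109,13)]) (Split 3 8 (Split 14 24 (Split 5 24 (Split 3 15
(Leaf 4 [:: (19,1); (20,4); (22,2); (41,2); (58,2); (68,1); (103,2); (105,1);
(106,2); (116,1)]) (Leaf 20 [:: (11,15); (19,8); (20,35); (22,10); (41,10);
(68,2); (96,10); (102,6); (103,31); (105,8); (106,20); (110,10); (114,10);
(117,8)])) (Split 3 15 (Leaf 4 [:: (19,1); (20,4); (22,2); (41,2); (58,2);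
(68,1); (103,2); (105,1); (106,2); (116,1)]) (Split 2 16 (Leaf 144 [:: (11,36);
(19,34); (20,180); (41,72); (49,72); (63,32); (102,7); (103,115); (105,34);
(106,96); (110,72); (112,16); (115,8); (117,40); (119,38)]) (Split 3 24 (Leaf 4
[:: (11,1); (19,1); (20,5); (41,2); (49,2); (63,1); (103,3); (105,1); (106,3);
(110,2); (117,1); (118,1); (120,1)]) (Split 1 15 (Leaf 124 [:: (11,31);
(19,28); (20,155); (41,68); (49,62); (63,12); (68,28); (103,93); (105,34);
(106,96); (108,6); (110,62); (112,16); (121,18); (122,16)]) (Leaf 28 [::
(11,11); (19,8); (20,39); (41,14); (49,14); (63,4); (68,6); (102,2); (103,27);
(105,8); (106,20); (110,14); (112,4); (121,2); (123,4)])))))) (Split 1 15 (Leaf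
4 [:: (11,1); (19,1); (20,5); (41,2); (49,2); (68,1); (103,3); (105,1);
(106,3); (110,2); (113,1); (114,1)]) (Leaf 28 [:: (11,11); (19,8); (20,39);
(41,14); (49,10); (63,2); (68,6); (98,4); (101,4); (102,2); (103,27); (105,8);
(106,20); (110,14); (113,6); (115,6)]))) (Split 2 14 (Leaf 80 [:: (19,12);
(20,80); (22,5); (26,10); (41,60); (49,35); (63,12); (68,8); (96,5); (102,4);
(103,44); (105,32); (106,50); (108,20); (111,50); (113,28)]) (Split 1 24 (Split
4 23 (Leaf 300 [:: (10,66); (20,234); (41,241); (49,106); (68,59); (101,44);
(102,18); (103,102); (105,91); (106,200); (108,91); (111,194); (112,100);
(114,50); (117,44)]) (Leaf 260 [:: (11,27); (19,28); (20,287); (41,232);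
(49,76); (63,28); (101,54); (102,28); (103,185); (105,130); (106,192);
(108,102); (111,184); (112,40); (114,62); (116,54)])) (Leaf 4 [:: (11,1);
(20,5); (41,4); (98,2); (101,2); (103,3); (105,2); (106,4); (108,2); (111,2);
(115,2)]))))))) (Split 3 21 (Split 2 20 (Leaf 204 [:: (8,48); (16,204);
(20,204); (27,100); (44,252); (53,2); (58,102); (93,15); (97,2); (101,102);
(102,117); (104,153); (105,3); (106,3); (107,105)]) (Split 3 8 (Split 20 17
(Leaf 20 [:: (9,1); (16,8); (20,30); (27,6); (32,4); (44,31); (49,8); (58,2);
(63,8); (74,12); (101,2); (102,20); (104,21); (108,4); (110,2)]) (Leaf 88 [::
(9,13); (16,16); (20,113); (32,44); (44,113); (49,26); (58,16); (63,28);
(74,38); (98,2); (101,18); (102,69); (104,69); (106,3); (108,44); (111,13)]))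
(Split 1 15 (Leaf 160 [:: (8,28); (16,48); (20,214); (32,80); (44,242);
(49,24); (58,56); (63,24); (74,54); (93,7); (101,56); (102,141); (104,162);
(106,48); (109,80); (110,8)]) (Leaf 4 [:: (16,1); (20,4); (32,2); (44,4);
(58,2); (101,2); (102,2); (104,2); (106,1); (109,2); (111,1)])))) (Split 2 20
(Split 14 21 (Split 4 23 (Split 2 14 (Leaf 14 [:: (10,3); (15,1); (16,5);
(20,7); (27,6); (41,13); (44,1); (49,3); (58,5); (73,4); (101,4); (105,6);
(107,11); (108,1); (110,1); (113,1)]) (Leaf 28 [:: (10,10); (15,10); (20,18);
(27,4); (41,34); (43,16); (49,14); (58,10); (69,6); (73,16); (91,12); (105,20);
(106,1); (107,37); (110,10); (112,4)])) (Leaf 4 [:: (15,1); (16,2); (20,2);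
(27,1); (41,6); (58,2); (69,2); (73,2); (98,1); (101,2); (105,4); (107,6);
(111,1)])) (Leaf 16 [:: (16,12); (20,8); (27,8); (41,8); (44,4); (49,4);
(58,4); (73,4); (75,4); (96,1); (97,1); (101,4); (106,2); (107,14); (109,4)]))
(Split 5 10 (Split 1 17 (Split 2 14 (Split 25 17 (Split 9 24 (Leaf 14 [::
(20,7); (27,7); (44,7); (49,7); (63,4); (68,1); (75,6); (106,1); (108,9);
(113,2); (114,1); (116,1)]) (Leaf 34 [:: (20,17); (27,17); (44,17); (49,17);
(68,13); (75,4); (106,2); (108,21); (110,11); (113,11); (114,2); (117,6)]))
(Split 5 24 (Split 17 22 (Split 1 26 (Leaf 84 [:: (9,18); (20,51); (27,28);
(44,39); (53,56); (57,42); (63,42); (75,27); (97,14); (102,3); (108,42);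
(116,42); (119,6); (121,3)]) (Leaf 108 [:: (9,12); (20,57); (27,46); (44,51);
(49,24); (53,38); (57,24); (63,48); (75,45); (97,8); (101,6); (102,3);
(108,60); (115,6); (116,30); (120,3)])) (Leaf 14 [:: (20,8); (27,7); (41,1);
(44,6); (49,7); (63,5); (68,2); (75,5); (108,6); (113,2); (118,1)])) (Leaf 14
[:: (20,7); (27,7); (34,3); (44,10); (49,7); (68,5); (75,2); (108,13); (109,4);
(110,3); (113,4); (115,2); (117,3)]))) (Leaf 8 [:: (10,1); (20,4); (27,4);
(44,4); (49,2); (58,2); (68,4); (101,2); (108,4); (110,3); (112,2)])) (Split 0
25 (Split 4 7 (Split 0 27 (Leaf 12 [:: (20,7); (27,6); (44,6); (49,2); (58,4);
(63,2); (68,4); (75,2); (101,3); (108,6); (111,3); (115,1); (117,1)]) (Leaf 56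
[:: (20,34); (27,28); (44,28); (58,28); (68,26); (75,2); (101,13); (102,2);
(108,30); (111,20); (113,2); (115,15); (116,4)])) (Leaf 72 [:: (27,36);
(44,38); (58,36); (68,8); (75,26); (91,36); (101,7); (105,2); (108,66);
(109,2); (111,46); (113,28); (114,29)])) (Split 1 15 (Split 2 14 (Leaf 120 [::
(20,60); (27,60); (44,73); (49,26); (58,34); (68,26); (75,21); (101,34);
(105,13); (106,6); (108,88); (111,39); (112,22); (114,6); (117,26)]) (Split 8
23 (Leaf 60 [:: (20,30); (27,30); (44,30); (49,8); (58,19); (68,16); (75,14);
(101,22); (108,40); (109,8); (111,16); (112,2); (114,12); (116,11); (119,3)])
(Leaf 120 [:: (20,60); (27,60); (44,60); (49,13); (58,44); (68,26); (75,34);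
(101,47); (108,80); (109,13); (111,26); (112,7); (114,27); (116,16);
(118,3)]))) (Split 3 8 (Leaf 56 [:: (20,28); (27,26); (30,2); (44,28); (58,26);
(63,2); (75,28); (98,2); (101,28); (106,3); (108,36); (112,5); (115,18);
(116,2)]) (Leaf 28 [:: (20,14); (27,13); (30,1); (44,14); (58,13); (63,1);
(75,14); (98,1); (101,14); (106,2); (108,18); (112,2); (115,9); (117,1)])))))
(Split 4 9 (Split 3 8 (Split 1 15 (Split 4 7 (Split 4 16 (Leaf 4 [:: (20,3);
(27,2); (44,2); (49,2); (63,2); (75,1); (102,1); (109,2); (119,1)]) (Split 1 17
(Split 3 17 (Leaf 6 [:: (20,1); (27,3); (44,3); (49,3); (63,3); (91,4);
(102,2); (109,3); (118,3); (122,5)]) (Split 5 24 (Leaf 12 [:: (20,9); (27,5);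
(44,6); (53,4); (58,3); (68,6); (97,1); (102,3); (109,6); (117,6); (123,3);
(124,3)]) (Split 2 16 (Leaf 28 [:: (20,18); (27,12); (44,14); (49,4); (53,8);
(58,2); (63,6); (68,8); (91,5); (102,9); (109,14); (112,2); (117,10); (120,10);
(125,6); (127,6)]) (Leaf 26 [:: (20,15); (27,9); (44,13); (49,5); (53,4);
(58,4); (63,9); (68,4); (91,4); (102,6); (109,13); (112,4); (117,8); (120,11);
(126,9)])))) (Leaf 4 [:: (20,3); (27,2); (44,2); (58,2); (68,2); (102,1);
(109,2); (117,2); (121,1)]))) (Split 5 23 (Split 2 16 (Split 3 15 (Split 1 21
(Leaf 92 [:: (10,4); (20,81); (22,38); (27,8); (44,65); (58,46); (68,20);
(75,7); (102,35); (109,46); (111,38); (116,8); (122,26); (124,19)]) (Leaf 92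
[:: (10,4); (20,81); (27,46); (44,65); (58,46); (68,20); (75,7); (102,35);
(109,46); (116,46); (122,26); (125,19)])) (Leaf 344 [:: (10,116); (20,228);
(22,13); (27,82); (44,172); (49,81); (58,168); (63,4); (102,56); (106,32);
(109,204); (111,90); (116,78); (118,77); (121,172); (123,136)])) (Leaf 4 [::
(10,2); (20,2); (44,2); (49,2); (51,4); (53,1); (63,2); (91,1); (102,1);
(109,2); (111,1); (112,1); (118,5); (120,2)])) (Split 1 21 (Split 7 23 (Split 3
13 (Leaf 16 [:: (9,3); (20,16); (26,12); (44,13); (58,8); (91,9); (101,6);
(102,17); (109,8); (111,20); (114,8); (119,18); (120,8); (121,3); (122,2);
(124,20)]) (Split 2 14 (Leaf 412 [:: (9,178); (20,383); (44,205); (49,148);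
(75,29); (76,18); (102,177); (109,206); (111,224); (114,206); (119,166);
(120,14); (121,15); (122,58); (125,264); (127,188)]) (Leaf 100 [:: (9,14);
(20,99); (44,85); (49,48); (58,4); (75,1); (102,49); (109,50); (111,50);
(112,48); (114,50); (120,42); (121,7); (122,2); (126,46)]))) (Leaf 64 [::
(9,20); (20,56); (27,16); (44,36); (49,16); (58,32); (75,8); (102,24);
(109,32); (111,16); (114,32); (120,6); (121,2); (122,7); (123,23)])) (Split 0
25 (Split 3 13 (Leaf 20 [:: (9,5); (20,19); (27,2); (44,12); (58,10); (68,2);
(75,1); (102,9); (109,10); (111,8); (114,8); (116,10); (119,8); (121,2);
(124,8)]) (Split 1 24 (Leaf 20 [:: (9,5); (20,19); (27,2); (44,12); (58,2);
(68,2); (75,1); (102,9); (109,18); (111,16); (116,10); (119,8); (121,2);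
(123,8); (125,16); (126,8)]) (Leaf 244 [:: (20,221); (27,114); (44,189);
(58,102); (68,32); (75,23); (102,99); (109,170); (111,28); (114,42); (116,122);
(119,8); (121,67); (123,48); (125,28); (127,20)]))) (Leaf 116 [:: (20,109);
(27,46); (44,101); (49,12); (58,58); (68,8); (75,7); (101,32); (102,51);
(109,90); (111,12); (114,18); (116,14); (119,12); (121,43); (122,32)])))))
(Split 3 23 (Split 26 17 (Leaf 112 [:: (9,41); (20,89); (27,31); (44,52);
(49,12); (58,56); (75,19); (98,13); (101,44); (102,33); (109,56); (111,25);
(114,32); (115,88); (116,25); (118,4)]) (Leaf 68 [:: (9,35); (20,47); (27,24);
(44,23); (49,4); (58,40); (63,4); (75,10); (78,10); (101,30); (102,13);
(109,24); (114,20); (115,60); (116,10); (119,11)])) (Split 0 26 (Leaf 28 [::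
(9,9); (20,22); (27,9); (44,13); (49,4); (58,10); (63,4); (75,6); (98,5);
(101,10); (102,8); (109,14); (111,5); (115,10); (117,5); (119,1)]) (Leaf 84 [::
(9,33); (20,62); (27,7); (44,29); (58,38); (63,4); (75,22); (98,27); (101,42);
(102,20); (109,42); (111,35); (112,12); (115,38); (117,23); (118,13)]))))
(Split 2 14 (Leaf 74 [:: (10,1); (20,59); (22,2); (40,11); (44,48); (49,35);
(58,2); (63,14); (68,23); (75,14); (102,22); (109,48); (111,37); (112,2);
(113,37); (115,21)]) (Split 1 24 (Leaf 4 [:: (20,4); (40,2); (44,4); (51,2);
(68,2); (101,2); (102,2); (109,4); (111,3); (113,4); (114,1); (116,1)]) (Leaf 4
[:: (20,4); (40,2); (44,4); (58,1); (68,2); (98,1); (101,2); (102,2); (109,4);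
(111,3); (113,2); (117,1)])))) (Split 3 8 (Split 3 15 (Leaf 44 [:: (20,39);
(22,18); (27,4); (44,31); (49,4); (58,18); (63,4); (68,8); (75,5); (102,17);
(105,9); (109,22); (110,18); (114,10)]) (Split 0 25 (Split 25 17 (Split 2 14
(Split 3 24 (Split 5 24 (Leaf 152 [:: (20,130); (44,150); (49,76); (75,2);
(76,29); (96,9); (97,38); (102,54); (105,74); (109,152); (110,152); (112,76);
(117,56); (118,48); (119,28); (124,47)]) (Leaf 404 [:: (20,447); (44,348);
(49,198); (61,4); (68,56); (96,4); (102,245); (105,146); (109,264); (110,404);
(112,206); (115,80); (117,105); (119,43); (122,103); (125,99)])) (Leaf 444 [::
(8,24); (20,459); (44,366); (49,222); (68,102); (102,237); (105,144);
(109,342); (110,432); (112,222); (117,135); (119,15); (120,140); (121,152);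
(123,210)])) (Split 1 24 (Leaf 612 [:: (11,9); (20,621); (44,498); (49,306);
(63,48); (68,114); (102,315); (105,192); (109,450); (110,552); (112,306);
(117,144); (120,328); (121,316); (122,246)]) (Leaf 92 [:: (11,4); (20,96);
(22,16); (44,92); (49,30); (58,16); (63,22); (102,50); (105,46); (109,70);
(110,85); (111,26); (112,30); (117,24); (121,5); (123,13)]))) (Split 3 24
(Split 5 24 (Leaf 84 [:: (9,15); (20,75); (22,42); (44,69); (58,26); (96,16);
(102,33); (105,27); (109,60); (110,58); (112,16); (115,24); (117,9); (119,9);
(122,16)]) (Leaf 172 [:: (11,17); (20,189); (44,148); (49,86); (63,4); (68,24);
(102,103); (105,62); (109,112); (110,168); (112,86); (115,32); (117,26);
(120,41); (123,41)])) (Leaf 44 [:: (20,53); (44,44); (49,22); (63,11);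
(102,31); (105,22); (109,24); (110,55); (111,22); (112,22); (115,9); (117,11);
(118,14); (119,5); (121,11)]))) (Split 14 24 (Split 2 14 (Leaf 176 [::
(20,160); (44,152); (49,88); (63,36); (68,8); (75,16); (102,72); (105,64);
(109,132); (110,88); (112,88); (116,51); (117,7); (121,52)]) (Leaf 360 [::
(20,333); (44,309); (49,180); (63,66); (68,24); (75,27); (102,153); (105,129);
(109,270); (110,201); (112,180); (116,90); (118,86); (119,65); (120,72)]))
(Split 1 15 (Leaf 48 [:: (9,8); (20,45); (44,35); (49,24); (68,2); (75,3);
(102,21); (105,11); (106,3); (109,31); (110,36); (112,24); (116,4); (119,12);
(120,15)]) (Leaf 116 [:: (9,10); (20,105); (44,95); (49,8); (58,46); (75,11);
(98,4); (101,50); (102,47); (105,37); (109,84); (110,64); (112,58); (116,26);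
(119,6); (121,32)]))))) (Split 2 14 (Leaf 176 [:: (20,160); (22,7); (26,14);
(44,152); (49,81); (63,36); (68,8); (75,16); (96,7); (102,72); (105,64);
(106,44); (109,132); (110,102); (113,102); (115,52)]) (Split 1 24 (Split 15 20
(Leaf 1468 [:: (20,1457); (44,1389); (49,734); (68,68); (75,11); (102,723);
(105,655); (106,554); (109,1344); (110,1102); (113,734); (114,366); (116,368);
(119,56)]) (Leaf 76 [:: (20,74); (44,68); (49,38); (68,6); (75,2); (102,36);
(105,30); (106,18); (109,63); (110,54); (113,38); (114,22); (116,16);
(118,7)])) (Leaf 316 [:: (11,14); (20,321); (26,30); (44,307); (58,46); (63,4);
(75,9); (98,112); (101,158); (102,163); (105,149); (106,154); (109,312);
(110,296); (113,188); (117,108)]))))))))) (Split 1 19 (Leaf 16 [:: (10,4);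
(15,8); (20,7); (27,8); (41,8); (68,8); (93,1); (94,5); (98,8); (100,8);
(102,8)]) (Split 1 15 (Split 4 22 (Split 4 23 (Leaf 36 [:: (10,4); (19,2);
(20,30); (25,3); (27,31); (32,2); (41,16); (68,16); (75,2); (98,5); (100,39);
(101,18); (103,18); (104,2); (107,12); (109,13)]) (Split 23 21 (Leaf 88 [::
(9,24); (19,37); (20,73); (27,64); (32,6); (41,27); (58,18); (83,11); (94,15);
(98,6); (100,70); (101,26); (103,26); (104,55); (107,29); (110,20)]) (Split 4 9
(Leaf 4 [:: (9,2); (20,4); (27,3); (41,2); (98,1); (100,4); (101,2); (103,2);
(104,2); (107,2); (108,1); (113,1)]) (Split 7 20 (Leaf 56 [:: (19,4); (20,48);
(27,54); (41,44); (75,8); (98,2); (100,57); (101,13); (103,28); (104,12);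
(107,20); (108,6); (111,20); (112,2); (115,16)]) (Leaf 4 [:: (11,3); (20,7);
(27,4); (41,4); (62,4); (100,14); (101,10); (103,6); (104,4); (107,5); (111,2);
(112,4); (114,2)]))))) (Leaf 4 [:: (9,1); (20,3); (25,2); (27,2); (41,2);
(75,1); (98,2); (100,6); (101,2); (103,2); (104,2); (106,1)])) (Split 4 22
(Split 3 21 (Leaf 4 [:: (11,2); (15,1); (16,2); (19,4); (20,6); (27,2); (58,1);
(98,1); (100,2); (103,1); (105,2); (107,4); (108,2)]) (Split 4 9 (Leaf 4 [::
(9,2); (20,4); (27,2); (41,2); (58,1); (98,1); (100,2); (103,1); (105,2);
(107,2); (111,1)]) (Split 7 20 (Leaf 4 [:: (11,1); (15,2); (20,5); (27,2);
(41,4); (98,2); (100,4); (103,2); (107,3); (109,2); (113,2)]) (Leaf 172 [::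
(9,48); (11,21); (19,24); (20,193); (27,86); (41,100); (58,46); (98,40);
(100,100); (103,40); (105,72); (107,107); (109,38); (110,40); (112,14)]))))
(Split 2 20 (Split 3 21 (Leaf 4 [:: (15,1); (16,4); (27,2); (46,4); (58,1);
(98,1); (100,2); (103,1); (106,2); (109,2); (110,2)]) (Leaf 4 [:: (15,1);
(16,2); (20,2); (27,2); (41,4); (58,1); (73,2); (98,1); (100,2); (103,1);
(109,4); (111,2)])) (Split 5 10 (Split 8 22 (Leaf 124 [:: (9,16); (15,25);
(20,16); (27,54); (46,62); (58,21); (63,24); (75,46); (98,41); (100,62);
(103,17); (105,30); (106,8); (108,8); (110,70); (113,8)]) (Leaf 148 [:: (9,16);
(15,27); (20,48); (27,58); (41,32); (46,42); (58,23); (63,40); (75,58);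
(98,51); (100,74); (103,11); (105,34); (110,42); (112,16)])) (Split 3 21 (Leaf
92 [:: (11,8); (16,37); (20,8); (27,46); (32,14); (46,92); (58,16); (63,16);
(98,30); (100,46); (103,14); (105,17); (106,54); (108,13); (111,8); (112,46)])
(Split 4 9 (Leaf 72 [:: (9,21); (20,21); (27,36); (46,38); (58,15); (63,8);
(75,13); (98,21); (100,36); (103,13); (105,26); (106,23); (108,2); (111,38);
(113,2); (115,13)]) (Split 8 21 (Leaf 392 [:: (9,28); (20,28); (46,351);
(58,94); (63,15); (75,13); (98,102); (100,196); (103,87); (105,39); (106,183);
(108,142); (111,338); (113,351); (114,283); (117,196)]) (Leaf 180 [:: (9,58);
(20,58); (27,56); (46,72); (58,44); (63,25); (75,50); (98,46); (100,90);
(103,21); (105,65); (106,40); (111,90); (113,16); (114,55); (116,34)]))))))))))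
(Split 8 22 (Split 2 20 (Leaf 4 [:: (11,3); (16,3); (20,2); (22,2); (32,2);
(44,2); (63,2); (73,3); (75,2); (99,2); (103,3)]) (Split 4 22 (Leaf 4 [::
(11,3); (20,5); (22,2); (32,2); (44,2); (63,2); (75,2); (99,2); (105,3)])
(Split 2 7 (Split 3 21 (Split 15 20 (Leaf 4 [:: (11,2); (16,3); (20,4); (27,2);
(44,4); (63,2); (73,2); (99,2); (104,2); (107,2); (108,2); (111,1)]) (Leaf 28
[:: (11,9); (16,16); (20,33); (27,14); (44,33); (49,5); (63,14); (65,5);
(73,4); (99,9); (104,19); (107,4); (108,19); (110,2)])) (Split 24 17 (Leaf 64
[:: (11,44); (20,96); (26,4); (32,32); (44,60); (63,36); (73,4); (75,4);
(98,13); (99,45); (100,11); (101,47); (104,28); (107,32); (109,28); (110,4)])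
(Split 1 23 (Leaf 0 [:: (11,60); (20,24); (26,18); (44,18); (63,18); (67,18);
(73,18); (98,35); (99,65); (100,15); (101,21); (104,18); (109,18); (111,18);
(112,12)]) (Leaf 0 [:: (11,60); (20,24); (26,18); (44,18); (63,18); (67,18);
(73,18); (98,11); (99,41); (100,15); (101,21); (104,18); (109,18); (111,18);
(113,12)])))) (Split 0 23 (Split 1 19 (Leaf 4 [:: (11,2); (12,1); (20,4);
(22,2); (32,6); (44,4); (59,2); (73,2); (84,2); (99,3); (102,2); (104,2);
(109,1); (110,4)]) (Split 3 8 (Split 1 21 (Leaf 84 [:: (11,12); (20,77);
(32,42); (44,65); (63,42); (75,19); (99,26); (101,6); (104,29); (106,42);
(109,16); (112,52); (114,23)]) (Leaf 28 [:: (11,12); (20,32); (22,5); (32,14);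
(44,20); (63,14); (75,8); (99,11); (101,12); (104,6); (106,9); (109,3);
(115,6)])) (Split 2 21 (Split 4 9 (Leaf 212 [:: (11,78); (20,106); (32,141);
(44,28); (59,35); (63,71); (75,184); (99,103); (102,35); (106,106); (109,38);
(111,70); (113,144); (115,78); (116,43); (117,78)]) (Split 5 10 (Leaf 28 [::
(11,2); (20,14); (32,12); (44,14); (63,5); (73,2); (75,14); (99,8); (102,11);
(106,14); (109,6); (111,9); (113,20); (116,11); (118,13)]) (Split 3 21 (Leaf 28
[:: (11,2); (16,2); (20,27); (32,23); (44,27); (63,5); (73,2); (75,1); (99,8);
(102,11); (104,13); (106,14); (109,6); (111,9); (113,20); (120,13)]) (Leaf 548
[:: (11,43); (20,520); (44,514); (63,99); (73,37); (75,34); (99,158);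
(102,212); (104,246); (106,274); (109,116); (111,175); (113,390); (116,449);
(119,486); (121,240)])))) (Leaf 196 [:: (11,132); (20,145); (32,150); (42,52);
(44,65); (59,52); (63,98); (75,131); (99,130); (101,66); (104,33); (106,98);
(109,20); (111,52); (113,52); (114,33)])))) (Leaf 4 [:: (11,1); (12,3); (20,2);
(22,2); (32,2); (44,2); (59,1); (63,3); (73,1); (75,2); (108,3)]))))) (Split 0
23 (Split 2 20 (Leaf 8 [:: (11,8); (16,6); (20,2); (22,4); (32,4); (63,4);
(73,6); (75,8); (87,2); (88,4); (98,1); (99,5); (100,1); (101,1); (104,2);
(105,10)]) (Split 2 7 (Split 5 10 (Split 0 25 (Split 4 7 (Split 0 27 (Leaf 12
[:: (7,1); (11,1); (20,7); (27,6); (44,6); (49,3); (63,6); (75,6); (99,3);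
(107,3); (108,6); (115,1)]) (Leaf 4 [:: (11,1); (20,3); (27,2); (44,2); (63,2);
(75,2); (99,2); (107,1); (108,2); (113,1); (114,1)])) (Leaf 8 [:: (11,1);
(20,4); (27,4); (44,4); (49,2); (63,4); (73,1); (75,4); (99,2); (107,1);
(108,5); (111,1); (112,1)])) (Leaf 4 [:: (11,1); (20,3); (27,2); (44,3);
(63,2); (73,1); (75,1); (89,1); (99,2); (107,2); (108,3); (110,1)])) (Split 4 7
(Leaf 4 [:: (20,2); (27,2); (29,1); (41,1); (63,2); (75,2); (98,1); (99,2);
(103,1); (109,1); (111,2)]) (Split 0 25 (Split 3 21 (Leaf 4 [:: (20,4); (22,1);
(32,3); (44,4); (63,1); (76,1); (99,1); (100,2); (110,1); (113,1); (114,2)])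
(Split 4 22 (Leaf 100 [:: (11,49); (20,105); (27,28); (32,22); (44,68);
(63,50); (73,12); (75,32); (99,50); (100,22); (109,40); (110,50); (113,12);
(115,18); (117,33)]) (Leaf 28 [:: (11,8); (20,25); (27,14); (44,23); (63,14);
(73,6); (75,5); (99,14); (109,20); (110,14); (113,6); (115,9); (116,11)])))
(Split 1 23 (Leaf 228 [:: (11,159); (16,105); (20,150); (27,18); (32,96);
(44,114); (63,114); (73,123); (75,114); (98,80); (99,254); (100,36); (107,114);
(109,36); (112,123); (114,60)]) (Split 0 24 (Leaf 32 [:: (11,34); (16,30);
(20,18); (32,15); (44,16); (63,17); (73,32); (75,16); (99,30); (100,2);
(106,13); (107,29); (109,2); (112,31); (115,14); (117,1)]) (Leaf 32 [::
(11,34); (16,30); (20,18); (32,15); (44,16); (63,17); (73,32); (75,16);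
(99,30); (100,2); (106,15); (107,31); (109,2); (112,31); (115,14);
(116,1)])))))) (Split 5 8 (Leaf 4 [:: (20,2); (22,1); (32,2); (44,2); (63,2);
(75,2); (99,1); (103,1); (106,1); (108,2)]) (Split 1 19 (Leaf 4 [:: (20,4);
(22,1); (32,4); (44,4); (80,2); (99,1); (100,2); (103,1); (104,2); (106,1);
(110,4)]) (Split 1 21 (Split 3 8 (Split 0 24 (Leaf 96 [:: (11,9); (20,83);
(32,42); (41,6); (44,74); (63,54); (73,6); (75,16); (99,29); (100,35);
(103,19); (106,57); (107,9); (112,32); (114,32); (117,6)]) (Split 1 20 (Leaf 4
[:: (20,4); (32,1); (44,4); (63,3); (99,1); (100,2); (103,1); (106,2); (112,2);
(114,3); (115,2); (116,1); (118,1)]) (Leaf 4 [:: (20,4); (32,1); (44,4);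
(63,3); (99,1); (100,2); (103,1); (106,2); (112,2); (114,1); (116,1);
(119,1)]))) (Split 2 22 (Leaf 140 [:: (11,66); (20,113); (32,70); (36,23);
(44,70); (59,23); (63,70); (75,70); (99,74); (100,33); (103,19); (106,70);
(111,23); (115,56); (117,33)]) (Leaf 28 [:: (11,11); (20,16); (32,14); (36,9);
(44,14); (59,9); (63,14); (75,14); (99,17); (103,6); (106,14); (109,11);
(111,9); (115,9); (116,11)]))) (Split 4 22 (Leaf 20 [:: (11,17); (20,33);
(32,4); (44,16); (63,16); (75,4); (78,6); (99,10); (100,2); (106,10); (109,8);
(113,6); (115,21)]) (Split 0 24 (Leaf 132 [:: (11,12); (20,115); (32,54);
(41,12); (44,103); (63,78); (73,12); (75,17); (99,40); (103,26); (106,84);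
(107,18); (109,92); (113,49); (114,49); (117,12)]) (Leaf 84 [:: (11,6);
(20,75); (32,36); (41,8); (44,69); (63,48); (73,8); (75,7); (84,2); (99,24);
(103,18); (106,42); (109,60); (113,33); (114,33); (116,6)])))))))) (Leaf 4 [::
(11,1); (12,3); (20,2); (22,2); (32,2); (44,2); (63,2); (71,1); (75,2);
(102,3)])))))%num.

Definition crit_certificate : tree :=
  foldr (fun pql t => Cut pql.1.1 pql.1.2 pql.2 t) crit_tree crit_cuts.

Lemma crit_certificateP :
  check crit_points crit_energy (Zpos 10) (Zpos 137) crit_order crit_certificate.
Proof. by vm_compute. Qed.

(** * The energy of a step function *)

Section Energy.
Variable R : realFieldType.
Implicit Types (s u x y h : R) (t : nat -> R) (i j k : nat).

Definition hinge u : R := Num.max u 0.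

Variant hinge_spec u : R -> Type :=
  | HingePos of 0 <= u : hinge_spec u u
  | HingeNeg of u <= 0 : hinge_spec u 0.

Lemma hingeP u : hinge_spec u (hinge u).
Proof.
rewrite /hinge; have [u0|u0] := leP u 0; first exact: HingeNeg.
exact/HingePos/ltW.
Qed.

Lemma hinge_ge0 u : 0 <= hinge u. Proof. by case: hingeP. Qed.

Lemma hinge_id u : 0 <= u -> hinge u = u.
Proof. by move=> u0; case: hingeP => // ?; lra. Qed.

Lemma hinge_eq0 u : u <= 0 -> hinge u = 0.
Proof. by move=> u0; case: hingeP => // ?; lra. Qed.

Lemma hinge_sqr u : hinge u ^+ 2 = u * hinge u.
Proof. by case: hingeP => _; rewrite ?expr2 ?mulr0 ?mul0r. Qed.

(** The square of the positive part is C^1 with Lipschitz derivative, so its expansion holds across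
    the kink. This makes the energy differentiable whatever the order of the points. *)
Lemma hinge_taylor u h :
  `|hinge (u + h) ^+ 2 - hinge u ^+ 2 - 2 * h * hinge u| <= h ^+ 2.
Proof.
by rewrite ler_norml; apply/andP; split; case: (hingeP u) => u0;
  case: (hingeP (u + h)) => uh0; nra.
Qed.

(* The area of { (x, y) | x >= s, y >= u, (1 - x)/2 < y < (1 + x)/2 } in the unit
   square. *)
Definition corner s u : R :=
  hinge (1 - u) ^+ 2 - hinge ((1 + s) / 2 - u) ^+ 2 - hinge ((1 - s) / 2 - u) ^+ 2.

(** [corner1] and [corner2] are the partial derivatives of [corner] in s and u. Replacing the
    constant 1 by a third variable makes [corner] homogeneous of degree 2; [corner_scale] is the
    derivative in that variable, and [corner_euler] is Euler's identity. *)
Definition corner1 s u : R := hinge ((1 - s) / 2 - u) - hinge ((1 + s) / 2 - u).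

Definition corner2 s u : R :=
  2 * (hinge ((1 + s) / 2 - u) + hinge ((1 - s) / 2 - u) - hinge (1 - u)).

Definition corner_scale s u : R :=
  2 * hinge (1 - u) - hinge ((1 + s) / 2 - u) - hinge ((1 - s) / 2 - u).

Lemma corner_taylor s u h a b : 0 <= a <= 1 -> 0 <= b <= 1 ->
  `|corner (s + h * a) (u + h * b) - corner s u
    - h * (a * corner1 s u + b * corner2 s u)| <= 4 * h ^+ 2.
Proof.
move=> /andP[a0 a1] /andP[b0 b1]; rewrite /corner.
have -> : 1 - (u + h * b) = 1 - u + - (h * b) by ring.
have -> : (1 + (s + h * a)) / 2 - (u + h * b) = (1 + s) / 2 - u + h * (a / 2 - b).
  by field.
have -> : (1 - (s + h * a)) / 2 - (u + h * b) = (1 - s) / 2 - u + - (h * (a / 2 + b)).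
  by field.
have := hinge_taylor (1 - u) (- (h * b)).
have := hinge_taylor ((1 + s) / 2 - u) (h * (a / 2 - b)).
have := hinge_taylor ((1 - s) / 2 - u) (- (h * (a / 2 + b))).
rewrite /corner1 /corner2 !ler_norml.
move=> /andP[l1 r1] /andP[l2 r2] /andP[l3 r3].
(* The three Taylor remainders add up to (3 b^2 + a^2/2) h^2, at most 7/2 h^2. *)
have sq : (h * b) ^+ 2 + (h * (a / 2 - b)) ^+ 2 + (h * (a / 2 + b)) ^+ 2 <= 4 * h ^+ 2.
  have -> : (h * b) ^+ 2 + (h * (a / 2 - b)) ^+ 2 + (h * (a / 2 + b)) ^+ 2 =
      (3 * b ^+ 2 + a ^+ 2 / 2) * h ^+ 2 by field.
  by apply: ler_wpM2r; [exact: sqr_ge0|nra].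
rewrite !sqrrN in l1 r1 l3 r3.
by apply/andP; split; lra.
Qed.

Lemma corner_euler s u :
  corner s u = (s * corner1 s u + u * corner2 s u + corner_scale s u) / 2.
Proof. by rewrite /corner /corner1 /corner2 /corner_scale !hinge_sqr; field. Qed.

Lemma corner_right u : 0 <= u -> corner 1 u = 0.
Proof.
move=> u0; rewrite /corner.
have -> : (1 + 1) / 2 - u = 1 - u by field.
have -> : (1 - 1) / 2 - u = - u by field.
by rewrite subrr sub0r (@hinge_eq0 (- u)) ?oppr_le0 // expr0n /= oppr0.
Qed.

Lemma corner_top s : 0 <= s <= 1 -> corner s 1 = 0.
Proof.
move=> /andP[s0 s1]; rewrite /corner !hinge_eq0; first by rewrite expr0n /= !subr0.
all: lra.
Qed.

(** Jumps of the step function: its initial value 1, then -2, 2, -2, ... at the breakpoints. *)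
Definition wt i : R := if i is 0%N then 1 else 2 * (-1) ^+ i.

(* The breakpoints of a step function g : [0, 1] -> {1, -1} starting with value 1;
   [t 0 = 0] carries the initial value. *)
Definition breaks t : Prop :=
  [/\ t 0%N = 0, forall i, (i < 5)%N -> t i <= t i.+1 & t 5%N <= 1].

(* The integral of g(x) g(y) over { (1 - x)/2 < y < (1 + x)/2 }. *)
Definition energy t : R :=
  \sum_(i < 6) \sum_(j < 6) wt i * wt j * corner (t i) (t j).

(* The even function with prim t x = int_0^x g for x >= 0. *)
Definition prim t x : R := \sum_(j < 6) wt j * hinge (`|x| - t j).

Definition shift t i h : nat -> R := fun j => t j + h * (j == i)%:R.

(** The partial derivative of the energy in [t i], divided by the jump [wt i]. *)
Definition slope t i : R :=
  \sum_(k < 6) wt k * (corner1 (t i) (t k) + corner2 (t k) (t i)).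

Lemma wt_abs i : `|wt i| <= 2.
Proof.
case: i => [|i] /=; first by rewrite normr1 ler1n.
by rewrite normrM normrX normrN normr1 expr1n mulr1 ger0_norm.
Qed.

(** There are 36 pairs, each with weight at most 2 * 2 and remainder at most 4 h^2. On the diagonal
    pair both coordinates move, hence the directions (a, b) in [corner_taylor]. *)
Lemma energy_taylor t i h : (i < 6)%N ->
  `|energy (shift t i h) - energy t - h * (wt i * slope t i)| <= 576 * h ^+ 2.
Proof.
move=> i6; pose I := Ordinal i6.
have -> : wt i * slope t i = \sum_(j < 6) \sum_(k < 6) wt j * wt k *
    ((j == I)%:R * corner1 (t j) (t k) + (k == I)%:R * corner2 (t j) (t k)).
  under eq_bigr => j _ do under eq_bigr => k _ do rewrite mulrDr.
  under eq_bigr => j _ do rewrite big_split /=.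
  rewrite big_split /= [X in _ = _ + X]exchange_big /=.
  rewrite (bigD1 I) //= [X in _ = _ + X + _]big1 ?addr0; last first.
    by move=> j /negPf jI; rewrite big1// => k _; rewrite jI mul0r mulr0.
  rewrite [X in _ = _ + X](bigD1 I) //= [X in _ = _ + (_ + X)]big1 ?addr0; last first.
    by move=> j /negPf jI; rewrite big1// => k _; rewrite jI mul0r mulr0.
  rewrite -big_split /= mulr_sumr; apply: eq_bigr => k _.
  by rewrite eqxx !mul1r; ring.
have -> : energy (shift t i h) - energy t - h * (\sum_(j < 6) \sum_(k < 6) wt j * wt k *
    ((j == I)%:R * corner1 (t j) (t k) + (k == I)%:R * corner2 (t j) (t k))) =
  \sum_(j < 6) \sum_(k < 6) wt j * wt k *
    (corner (t j + h * (j == I)%:R) (t k + h * (k == I)%:R) - corner (t j) (t k)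
     - h * ((j == I)%:R * corner1 (t j) (t k) + (k == I)%:R * corner2 (t j) (t k))).
  rewrite /energy mulr_sumr -!sumrB; apply: eq_bigr => j _.
  rewrite mulr_sumr -!sumrB; apply: eq_bigr => k _.
  by rewrite /shift -!val_eqE /=; ring.
apply: (le_trans (ler_norm_sum _ _ _)).
have -> : 576 * h ^+ 2 = \sum_(j < 6) 96 * h ^+ 2.
  by rewrite sumr_const card_ord -mulrnAl -mulr_natr; congr (_ * _); ring.
apply: ler_sum => j _; apply: (le_trans (ler_norm_sum _ _ _)).
have -> : 96 * h ^+ 2 = \sum_(j < 6) 16 * h ^+ 2.
  by rewrite sumr_const card_ord -mulrnAl -mulr_natr; congr (_ * _); ring.
apply: ler_sum => k _; rewrite !normrM.
have -> : 16 * h ^+ 2 = 2 * 2 * (4 * h ^+ 2) by ring.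
apply: ler_pM; rewrite ?mulr_ge0 //.
  by apply: ler_pM => //; exact: wt_abs.
by apply: corner_taylor; case: (_ == I); rewrite ?lexx ?ler01.
Qed.

Lemma breaks_ge0 t i : breaks t -> (i < 6)%N -> 0 <= t i.
Proof.
move=> [t0 tS _]; elim: i => [_|i IH i6]; first by rewrite t0.
exact: le_trans (IH (ltnW i6)) (tS _ _).
Qed.

Lemma breaks_le1 t i : breaks t -> (i < 6)%N -> t i <= 1.
Proof.
move=> [_ tS t5] i6; suff H k : (k <= 5)%N -> t (5 - k)%N <= 1.
  by rewrite -(subKn (_ : (i <= 5)%N))//; apply: H; rewrite leq_subr.
elim: k => [_|k IH k5]; first by rewrite subn0.
apply: le_trans (tS _ _) _; first by lia.
by rewrite -subSn// subSS IH// ltnW.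
Qed.

(** Each side is the length of the part of [x, y] to the right of v, respectively u. *)
Lemma hinge_diff_antitone x y u v : x <= y -> u <= v ->
  hinge (y - v) - hinge (x - v) <= hinge (y - u) - hinge (x - u).
Proof.
move=> xy uv; case: (hingeP (y - v)); case: (hingeP (x - v));
  case: (hingeP (y - u)); case: (hingeP (x - u)); lra.
Qed.

Lemma prim0 t : breaks t -> prim t 0 = 0.
Proof.
move=> tb; rewrite /prim big1// => j _; rewrite normr0 sub0r hinge_eq0 ?mulr0//.
by rewrite oppr_le0 breaks_ge0.
Qed.

(** Let d_j be the length of [x, y] beyond t_j. The increment is (y - x) - 2 (d_1 - d_2 + ... +
    d_5), and an alternating sum of decreasing nonnegative terms lies between 0 and d_1 <= y - x. *)
Lemma prim_lip_pos t x y : breaks t -> 0 <= x <= y ->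
  `|prim t y - prim t x| <= y - x.
Proof.
move=> [t0 tS _] /andP[x0 xy]; have y0 : 0 <= y by exact: le_trans xy.
rewrite /prim -sumrB.
under eq_bigr => j _ do rewrite -mulrBr (ger0_norm x0) (ger0_norm y0).
have d i (i5 : (i < 5)%N) := hinge_diff_antitone xy (tS i i5).
have := d 0%N isT; have := d 1%N isT; have := d 2%N isT; have := d 3%N isT.
have := d 4%N isT; have : 0 <= hinge (y - t 5%N) - hinge (x - t 5%N).
  by case: (hingeP (y - t 5%N)); case: (hingeP (x - t 5%N)); lra.
rewrite !big_ord_recl big_ord0 /wt /= /bump /= t0 !subr0.
rewrite (hinge_id x0) (hinge_id y0) ler_norml => *.
by apply/andP; split; lra.
Qed.

Lemma prim_abs t x : prim t `|x| = prim t x.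
Proof. by rewrite /prim normr_id. Qed.

Lemma prim_lip t x y : breaks t -> `|prim t y - prim t x| <= `|y - x|.
Proof.
move=> tb; rewrite -(prim_abs t x) -(prim_abs t y).
apply: le_trans (ler_dist_dist y x).
have [xy|yx] := leP `|x| `|y|.
  by rewrite [X in _ <= X]ger0_norm ?subr_ge0//; apply: prim_lip_pos; rewrite ?normr_ge0.
rewrite distrC [X in _ <= X]distrC [X in _ <= X]ger0_norm ?subr_ge0 ?(ltW yx)//.
by apply: prim_lip_pos; rewrite ?normr_ge0 ?(ltW yx).
Qed.

Lemma breaks_mono t j k : breaks t -> (j <= k)%N -> (k < 6)%N -> t j <= t k.
Proof.
move=> [_ tS _] jk; elim: k jk => [|k IH]; first by rewrite leqn0 => /eqP ->.
rewrite leq_eqVlt => /predU1P[->//|jk] k6.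
exact: le_trans (IH jk (ltnW k6)) (tS _ _).
Qed.

Lemma prim_break t i : breaks t -> (i < 5)%N ->
  prim t (t i.+1) = prim t (t i) + (-1) ^+ i * (t i.+1 - t i).
Proof.
move=> tb i5.
have hE j k : (j < 6)%N -> (k < 6)%N -> hinge (t j - t k) = if (k <= j)%N then t j - t k else 0.
  move=> j6 k6; case: ifP => [kj|/negbT]; first by rewrite hinge_id// subr_ge0 breaks_mono.
  by rewrite -ltnNge => jk; rewrite hinge_eq0// subr_le0 breaks_mono// ltnW.
have i6 : (i < 6)%N by exact: ltn_trans i5 _.
rewrite /prim !ger0_norm ?breaks_ge0//.
under eq_bigr => j _ do rewrite hE//.
under [in RHS]eq_bigr => j _ do rewrite hE//.
by move: i i5 {i6} => [|[|[|[|[|i]]]]] //= _;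
  rewrite !big_ord_recl !big_ord0 /wt /= /bump /= ?expr0 ?expr1; ring.
Qed.

Lemma prim_1 t : breaks t -> prim t 1 = prim t (t 5%N) - (1 - t 5%N).
Proof.
move=> tb; rewrite /prim normr1 (ger0_norm (breaks_ge0 tb (isT : (5 < 6)%N))).
under eq_bigr => j _ do rewrite hinge_id ?subr_ge0 ?breaks_le1//.
under [in RHS]eq_bigr => j _ do rewrite hinge_id ?subr_ge0 ?(breaks_mono (k := 5)) -1?ltnS//.
by rewrite !big_ord_recl !big_ord0 /wt /= /bump /=; ring.
Qed.

(** The band meets the line x = t_i in ((1 - t_i)/2, (1 + t_i)/2) and the line y = t_i in (|2 t_i -
    1|, 1). The slope is minus the sum of the integrals of g over these two sections. *)
Lemma slopeE t i : breaks t -> (i < 6)%N -> slope t i =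
  prim t (2 * t i - 1) - prim t 1 - (prim t ((1 + t i) / 2) - prim t ((1 - t i) / 2)).
Proof.
move=> tb i6; have t0 := breaks_ge0 tb i6; have t1 := breaks_le1 tb i6.
rewrite /slope /prim -!sumrB; apply: eq_bigr => k _; rewrite -!mulrBr; congr (_ * _).
have k0 := breaks_ge0 tb (ltn_ord k); have k1 := breaks_le1 tb (ltn_ord k).
rewrite normr1 (@ger0_norm _ ((1 + t i) / 2)); last lra.
rewrite (@ger0_norm _ ((1 - t i) / 2)); last lra.
rewrite /corner1 /corner2 (@hinge_id (1 - t i)) ?(@hinge_id (1 - t k)) ?subr_ge0//.
(* With c = 2 t_i - 1 the left side is [hinge (t k - c) + hinge (- c - t k) - (1 - c)], and
   [hinge v - hinge (- v) = v] does the rest for either sign of c. *)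
have -> : 2 * (hinge ((1 + t k) / 2 - t i) + hinge ((1 - t k) / 2 - t i) - (1 - t i)) =
    hinge (`|2 * t i - 1| - t k) - (1 - t k).
  have [c0|c0] := leP 0 (2 * t i - 1).
    rewrite (ger0_norm c0); case: (hingeP ((1 + t k) / 2 - t i));
    case: (hingeP ((1 - t k) / 2 - t i)); case: (hingeP (2 * t i - 1 - t k)); lra.
  rewrite (ltr0_norm c0); case: (hingeP ((1 + t k) / 2 - t i));
  case: (hingeP ((1 - t k) / 2 - t i)); case: (hingeP (- (2 * t i - 1) - t k)); lra.
ring.
Qed.

(* Euler's identity for the energy, homogeneous of degree 2 in (1, t). *)
Lemma energy_euler t : breaks t -> energy t =
  (\sum_(i < 6) t i * (wt i * slope t i)) / 2 - prim t 1
  - (\sum_(i < 6) wt i * (prim t ((1 + t i) / 2) + prim t ((1 - t i) / 2))) / 2.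
Proof.
move=> tb; have t0 i := @breaks_ge0 t i tb; have t1 i := @breaks_le1 t i tb.
have -> : energy t = (\sum_(i < 6) \sum_(j < 6) wt i * wt j * (t i * corner1 (t i) (t j))
   + \sum_(i < 6) \sum_(j < 6) wt i * wt j * (t j * corner2 (t i) (t j))
   + \sum_(i < 6) \sum_(j < 6) wt i * wt j * corner_scale (t i) (t j)) / 2.
  rewrite -!big_split /= mulr_suml; apply: eq_bigr => i _.
  rewrite -!big_split /= mulr_suml; apply: eq_bigr => j _.
  by rewrite corner_euler; field.
rewrite [X in _ + X + _]exchange_big /= -big_split /=.
have -> : \sum_(i < 6) (\sum_(j < 6) wt i * wt j * (t i * corner1 (t i) (t j)) +
    \sum_(i0 < 6) wt i0 * wt i * (t i * corner2 (t i0) (t i))) =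
    \sum_(i < 6) t i * (wt i * slope t i).
  apply: eq_bigr => i _; rewrite -big_split /= /slope !mulr_sumr; apply: eq_bigr => k _.
  ring.
have -> : \sum_(i < 6) \sum_(j < 6) wt i * wt j * corner_scale (t i) (t j) =
  \sum_(i < 6) wt i * (2 * prim t 1 - (prim t ((1 + t i) / 2) + prim t ((1 - t i) / 2))).
  apply: eq_bigr => i _; rewrite /prim mulr_sumr -big_split -sumrB mulr_sumr /=.
  apply: eq_bigr => j _; rewrite normr1 !ger0_norm.
  - by rewrite /corner_scale; ring.
  - by have := t1 _ (ltn_ord i); lra.
  - by have := t0 _ (ltn_ord i); lra.
under [X in _ + X]eq_bigr => i _ do rewrite mulrBr.
rewrite sumrB -mulr_suml.
(* The weights add up to the last value of g, which yields the term [- prim t 1]. *)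
have -> : \sum_(i < 6) wt i = -1 by rewrite !big_ord_recl big_ord0 /wt /= /bump /=; ring.
by field.
Qed.

End Energy.

Arguments zR : simpl never.

(** * The energy bound at critical points *)

Section CriticalPoints.
Variable R : realFieldType.
Implicit Type t : nat -> R.

Lemma slope_at0 t i : breaks t -> (i < 6)%N -> t i = 0 -> slope t i = 0.
Proof.
move=> tb i6 ti0; rewrite slopeE// ti0 mulr0 sub0r addr0 subr0 subrr subr0.
by rewrite /prim normrN subrr.
Qed.

Lemma prim_breaksE t : breaks t ->
  [/\ prim t (t 1%N) = t 1%N,
      prim t (t 2%N) = 2 * t 1%N - t 2%N,
      prim t (t 3%N) = 2 * t 1%N - 2 * t 2%N + t 3%N &
  [/\ prim t (t 4%N) = 2 * t 1%N - 2 * t 2%N + 2 * t 3%N - t 4%N,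
      prim t (t 5%N) = 2 * t 1%N - 2 * t 2%N + 2 * t 3%N - 2 * t 4%N + t 5%N &
      prim t 1 = 2 * t 1%N - 2 * t 2%N + 2 * t 3%N - 2 * t 4%N + 2 * t 5%N - 1]].
Proof.
move=> tb; rewrite prim_1// !prim_break//; have [-> _ _] := tb; rewrite prim0//.
by do 2 ?split; ring.
Qed.

Lemma zR_pos (p : positive) : zR R (Zpos p) = (Pos.to_nat p)%:R.
Proof. by []. Qed.

Lemma zR_neg (p : positive) : zR R (Zneg p) = - (Pos.to_nat p)%:R.
Proof. by rewrite /zR -[Zneg p]/(Z.opp (Zpos p)) (rmorphN int_of_Z (Zpos p)) mulrNz. Qed.

Definition crit_env t : seq R :=
  [:: t 1%N; t 2%N; t 3%N; t 4%N; t 5%N; prim t (1 / 2);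
      prim t ((1 + t 1%N) / 2); prim t ((1 + t 2%N) / 2); prim t ((1 + t 3%N) / 2);
      prim t ((1 + t 4%N) / 2); prim t ((1 + t 5%N) / 2);
      prim t ((1 - t 1%N) / 2); prim t ((1 - t 2%N) / 2); prim t ((1 - t 3%N) / 2);
      prim t ((1 - t 4%N) / 2); prim t ((1 - t 5%N) / 2)].

Lemma crit_pointsP t : breaks t -> (forall i, (0 < i < 6)%N -> slope t i = 0) ->
  forall p, p \in crit_points ->
  evalf (1 :: crit_env t) p.2 = 2 * prim t (evalf (1 :: crit_env t) p.1 / 2).
Proof.
move=> tb crit; have [e1 e2 e3 [e4 e5 e6]] := prim_breaksE tb.
have Q i : (0 < i < 6)%N -> prim t (2 * t i - 1) =
    prim t ((1 + t i) / 2) - prim t ((1 - t i) / 2) + prim t 1.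
  by move=> i6; have := crit i i6; rewrite slopeE//; [lra|case/andP: i6].
(* The sign of 2 t_i - 1 is not known in advance, so both it and its negative serve as points, with
   the same value. *)
have Qm i : (0 < i < 6)%N -> prim t (1 - 2 * t i) =
    prim t ((1 + t i) / 2) - prim t ((1 - t i) / 2) + prim t 1.
  by move=> i6; rewrite -Q// -[in RHS]prim_abs distrC prim_abs.
have ptP x v w : v = 2 * prim t x -> w = 2 * x -> v == 2 * prim t (w / 2).
  by move=> -> ->; apply/eqP; congr (2 * prim t _); field.
have p0 := prim0 tb.
have [n1 n2 n4] : [/\ Pos.to_nat 1 = 1%N, Pos.to_nat 2 = 2%N & Pos.to_nat 4 = 4%N] by [].
suff /allP H : all (fun p => evalf (1 :: crit_env t) p.2 ==
    2 * prim t (evalf (1 :: crit_env t) p.1 / 2)) crit_points by move=> p /H /eqP.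
rewrite /crit_points /crit_env /= !zR_pos !zR_neg ?zR0 n1 n2 n4.
clear crit.
apply/andP; split; first by apply: (ptP (0)); [rewrite p0; ring|ring].
apply/andP; split; first by apply: (ptP (t 1%N)); [rewrite e1; ring|ring].
apply/andP; split; first by apply: (ptP (t 2%N)); [rewrite e2; ring|ring].
apply/andP; split; first by apply: (ptP (t 3%N)); [rewrite e3; ring|ring].
apply/andP; split; first by apply: (ptP (t 4%N)); [rewrite e4; ring|ring].
apply/andP; split; first by apply: (ptP (t 5%N)); [rewrite e5; ring|ring].
apply/andP; split; first by apply: (ptP (1)); [rewrite e6; ring|ring].
apply/andP; split; first by apply: (ptP (1 / 2)); [ring|field].
apply/andP; split; first by apply: (ptP ((1 + t 1%N) / 2)); [ring|field].
apply/andP; split; first by apply: (ptP ((1 + t 2%N) / 2)); [ring|field].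
apply/andP; split; first by apply: (ptP ((1 + t 3%N) / 2)); [ring|field].
apply/andP; split; first by apply: (ptP ((1 + t 4%N) / 2)); [ring|field].
apply/andP; split; first by apply: (ptP ((1 + t 5%N) / 2)); [ring|field].
apply/andP; split; first by apply: (ptP ((1 - t 1%N) / 2)); [ring|field].
apply/andP; split; first by apply: (ptP ((1 - t 2%N) / 2)); [ring|field].
apply/andP; split; first by apply: (ptP ((1 - t 3%N) / 2)); [ring|field].
apply/andP; split; first by apply: (ptP ((1 - t 4%N) / 2)); [ring|field].
apply/andP; split; first by apply: (ptP ((1 - t 5%N) / 2)); [ring|field].
apply/andP; split; first by apply: (ptP (2 * t 1%N - 1)); [rewrite Q// e6; ring|ring].
apply/andP; split; first by apply: (ptP (2 * t 2%N - 1)); [rewrite Q// e6; ring|ring].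
apply/andP; split; first by apply: (ptP (2 * t 3%N - 1)); [rewrite Q// e6; ring|ring].
apply/andP; split; first by apply: (ptP (2 * t 4%N - 1)); [rewrite Q// e6; ring|ring].
apply/andP; split; first by apply: (ptP (2 * t 5%N - 1)); [rewrite Q// e6; ring|ring].
apply/andP; split; first by apply: (ptP (1 - 2 * t 1%N)); [rewrite Qm// e6; ring|ring].
apply/andP; split; first by apply: (ptP (1 - 2 * t 2%N)); [rewrite Qm// e6; ring|ring].
apply/andP; split; first by apply: (ptP (1 - 2 * t 3%N)); [rewrite Qm// e6; ring|ring].
apply/andP; split; first by apply: (ptP (1 - 2 * t 4%N)); [rewrite Qm// e6; ring|ring].
apply/andP; split; first by apply: (ptP (1 - 2 * t 5%N)); [rewrite Qm// e6; ring|ring].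
by [].
Qed.

Lemma energy_critical t : breaks t -> (forall i, (0 < i < 6)%N -> slope t i = 0) ->
  - (10 / 137) <= energy t.
Proof.
move=> tb crit; have ptsG := crit_pointsP tb crit; have [t0 tS t5] := tb.
have [n1 n2] : [/\ Pos.to_nat 1 = 1%N & Pos.to_nat 2 = 2%N] by [].
(* Doubling positions and values keeps the Lipschitz constant and clears the halves, so integer
   coefficients suffice. *)
have lipG x y : `|2 * prim t (y / 2) - 2 * prim t (x / 2)| <= `|y - x|.
  have := prim_lip (x / 2) (y / 2) tb; rewrite -mulrBr -mulrBl !normrM.
  by rewrite (@ger0_norm _ 2)// (@ger0_norm _ 2^-1) ?invr_ge0//; lra.
have G0 : 2 * prim t (0 / 2) = 0 by rewrite mul0r prim0// mulr0.
have ordE f : f \in crit_order -> 0 <= evalf (1 :: crit_env t) f.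
  have s0 := tS 0%N isT; have s1 := tS 1%N isT; have s2 := tS 2%N isT.
  have s3 := tS 3%N isT; have s4 := tS 4%N isT; rewrite t0 in s0.
  clear tS crit ptsG lipG G0 tb.
  rewrite /crit_order /crit_env !inE => /or4P[|||/or3P[]] /eqP ->;
    rewrite /= ?zR_pos ?zR_neg ?zR0 n1; lra.
have := @check_sound R (crit_env t) (fun x => 2 * prim t (x / 2)) crit_points crit_energy
  (Zpos 10) (Zpos 137) crit_order crit_certificate erefl lipG G0 ptsG ordE crit_certificateP.
rewrite /crit_energy /crit_env /= !zR_pos !zR_neg ?zR0 n1 n2.
have [-> ->] : Pos.to_nat 10 = 10%N /\ Pos.to_nat 137 = 137%N by lia.
rewrite energy_euler// [X in X / 2 - _ - _]big1; last first.
  move=> [[|i] i6] _ /=; first by rewrite t0 mul0r.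
  by rewrite crit// !mulr0.
have [_ _ _ [_ _ ->]] := prim_breaksE tb.
rewrite !big_ord_recl big_ord0 /wt /= /bump /= t0 subr0.
rewrite !addn0 !add1n !addr0; clear; lra.
Qed.

End CriticalPoints.

(** * Existence of a minimizer and removal of degenerate breakpoints *)

Section Descent.
Variable R : realType.
Implicit Type t : nat -> R.

Lemma hinge_cvg (T : Type) (F : set_system T) (f : T -> R) (l : R) : Filter F ->
  f x @[x --> F] --> l -> hinge (f x) @[x --> F] --> hinge l.
Proof.
move=> FF fl; have hE u : hinge u = (u + `|u|) / 2 :> R.
  by case: hingeP => u0; rewrite ?(ger0_norm u0) ?(ler0_norm u0); field.
rewrite hE; under eq_cvg do rewrite hE.
by apply: cvgMr_tmp; apply: cvgD => //; exact: cvg_norm.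
Qed.

Lemma corner_cvg (T : Type) (F : set_system T) (f g : T -> R) (s u : R) : Filter F ->
  f x @[x --> F] --> s -> g x @[x --> F] --> u ->
  corner (f x) (g x) @[x --> F] --> corner s u.
Proof.
move=> FF fs gu; rewrite /corner !expr2; under eq_cvg do rewrite !expr2.
have hs (a b : T -> R) (c d : R) : a x @[x --> F] --> c -> b x @[x --> F] --> d ->
    hinge (a x - b x) * hinge (a x - b x) @[x --> F] --> hinge (c - d) * hinge (c - d).
  by move=> ac bd; apply: cvgM; apply: hinge_cvg; apply: cvgB.
apply: cvgB; [apply: cvgB|].
- by apply: (hs (fun=> 1) g) => //; exact: cvg_cst.
- apply: (hs (fun x => (1 + f x) / 2) g) => //.
  by apply: cvgMr_tmp; apply: cvgD => //; exact: cvg_cst.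
- apply: (hs (fun x => (1 - f x) / 2) g) => //.
  by apply: cvgMr_tmp; apply: cvgB => //; exact: cvg_cst.
Qed.

Lemma energy_cvg (T : Type) (F : set_system T) (f : T -> nat -> R) t : Filter F ->
  (forall i, (i < 6)%N -> f x i @[x --> F] --> t i) ->
  energy (f x) @[x --> F] --> energy t.
Proof.
move=> FF ft; apply: cvg_big => [|i _]; first exact: add_continuous.
apply: cvg_big => [|j _]; first exact: add_continuous.
by apply: cvgMl_tmp; apply: corner_cvg; apply: ft.
Qed.

(** Breakpoints as points of R^5, where they form a closed subset of the cube [0, 1]^5. *)
Definition row_breaks (v : 'rV[R]_5) : nat -> R :=
  fun i => if i is k.+1 then v ord0 (inord k) else 0.

Lemma row_breaks_cvg i : continuous (fun v : 'rV[R]_5 => row_breaks v i).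
Proof.
case: i => [|i] v; first by move=> A; apply: (@cvg_cst R 0 'rV[R]_5 (nbhs v)).
exact: (@coord_continuous R 1 5 ord0 (inord i) v).
Qed.

Lemma breaks_compact : compact [set v | breaks (row_breaks v)].
Proof.
apply: (@subclosed_compact _ _ [set v : 'rV[R]_5 | forall i, `[0, 1]%classic (v ord0 i)]).
- rewrite [X in closed X](_ : _ = \bigcap_(i in `I_5)
      (fun v => row_breaks v i - row_breaks v i.+1) @^-1` [set x | x <= 0] `&`
      (fun v => row_breaks v 5%N - 1) @^-1` [set x | x <= 0]); last first.
    apply/seteqP; split => v /=.
      by move=> [_ vS v5]; split => [i /= i5|]; rewrite subr_le0//; exact: vS.
    move=> [vS v5]; split => // [i i5|]; last by rewrite -subr_le0.
    by rewrite -subr_le0; exact: vS.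
  apply: closedI; first apply: closed_bigI => i _.
    apply: preimage_closed; last exact: closed_le.
    move=> v _; apply: (@cvgB _ _ _ (nbhs v) _ (fun w => row_breaks w i)
      (fun w => row_breaks w i.+1)); [exact: (@row_breaks_cvg i v)|].
    exact: (@row_breaks_cvg i.+1 v).
  apply: preimage_closed; last exact: closed_le.
  move=> v _; apply: (@cvgB _ _ _ (nbhs v) _ (fun w => row_breaks w 5%N) (fun=> 1)).
    exact: (@row_breaks_cvg 5%N v).
  exact: cvg_cst.
- apply: (@rV_compact R 5 (fun=> `[0, 1]%classic)) => _.
  exact: segment_compact.
- move=> v vb i; have i6 : (i.+1 < 6)%N by rewrite ltnS.
  have := breaks_ge0 vb i6; have := breaks_le1 vb i6.
  by rewrite /= inord_val in_itv /= => -> ->.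
Qed.

Lemma breaks_congr t u : (forall i, (i < 6)%N -> t i = u i) -> breaks t -> breaks u.
Proof.
move=> tu [t0 tS t5]; split; rewrite -?tu// => i i5.
by have i6 : (i < 6)%N := ltn_trans i5 (ltnSn 5); rewrite -!tu//; exact: tS.
Qed.

Lemma energy_congr t u : (forall i, (i < 6)%N -> t i = u i) -> energy t = energy u.
Proof. by move=> tu; apply: eq_bigr => i _; apply: eq_bigr => j _; rewrite !tu. Qed.

Definition minimizer t : Prop := breaks t /\ forall u, breaks u -> energy t <= energy u.

Lemma minimizer_exists : exists t, minimizer t.
Proof.
have rowK t : breaks t -> forall i, (i < 6)%N -> row_breaks (\row_j t j.+1) i = t i.
  by move=> [t0 _ _] [|i] i6 //=; rewrite mxE inordK.
have A0 : [set v | breaks (row_breaks v)] !=set0.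
  exists 0; split => [//|i _|]; last by rewrite /row_breaks mxE ler01.
  by case: i => [|i]; rewrite /row_breaks !mxE.
have cont : continuous (fun v : 'rV[R]_5 => energy (row_breaks v)).
  move=> v; apply: (@energy_cvg _ (nbhs v) row_breaks (row_breaks v) (nbhs_filter v)).
  by move=> i _; exact: (@row_breaks_cvg i v).
have [v] := EVT_min_rV A0 breaks_compact (continuous_subspaceT cont).
rewrite inE /= => vb vmin; exists (row_breaks v); split => // u ub.
rewrite -(energy_congr (rowK u ub)); apply: vmin; apply/mem_set.
by apply: breaks_congr (ub) => i i6; rewrite (rowK u ub).
Qed.

Lemma minimizer_slope t i (e : R) : minimizer t -> (i < 6)%N -> 0 < e ->
  (forall h, `|h| <= e -> breaks (shift t i h)) -> slope t i = 0.
Proof.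
move=> [_ tmin] i6 e0 sb; set D := wt R i * slope t i.
have key h : `|h| <= e -> - (576 * h ^+ 2) <= h * D.
  move=> he; have := energy_taylor t h i6; have := tmin _ (sb h he).
  by rewrite -/D ler_norml => ? /andP[? ?]; lra.
have D0 : D = 0.
  apply/eqP/negPn/negP => Dn0.
  (* Since 1152 = 2 * 576, a step of length d against the sign of D gains d |D| at first order and
     loses at most half of it at second order. *)
  pose d := Num.min e (`|D| / 1152); have nD : 0 < `|D| by rewrite normr_gt0.
  have d0 : 0 < d by rewrite lt_min e0 /=; lra.
  have de : d <= e by rewrite ge_min lexx.
  have dD : d <= `|D| / 1152 by rewrite ge_min lexx orbT.
  have [Dp|Dn] := leP 0 D.
    have := key (- d); rewrite normrN (gtr0_norm d0) => /(_ de).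
    by rewrite ger0_norm// in nD dD; nra.
  have := key d; rewrite (gtr0_norm d0) => /(_ de).
  by rewrite ltr0_norm// in nD dD; nra.
move/eqP: D0; rewrite mulf_eq0 => /orP[|/eqP//]; case: (i) => [|k] /=.
  by rewrite oner_eq0.
by rewrite mulf_eq0 pnatr_eq0 /= expf_eq0 oppr_eq0 oner_eq0 andbF.
Qed.

(** Induction measure for [minimizer_bound]: the breakpoints not yet moved to 0. *)
Definition nonzeros t : nat := (\sum_(i < 6) (t i != 0%R))%N.

(* Two coinciding breakpoints cancel, and so do two breakpoints at 0. *)
Definition drop_pair t i : nat -> R := fun j => if (j <= i.+1)%N then t (j - 2)%N else t j.

Lemma drop_pair_breaks t i : breaks t -> (0 < i < 5)%N -> breaks (drop_pair t i).
Proof.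
move=> tb /andP[i0 i5]; have [t0 tS t5] := tb; split; rewrite /drop_pair.
- by rewrite leq0n.
- move=> j j5; case: (leqP j i.+1) => h1; case: (leqP j.+1 i.+1) => h2.
  + by apply: breaks_mono => //; lia.
  + by apply: breaks_mono => //; lia.
  + by lia.
  + exact: tS.
- by case: ifP => // _; exact: breaks_le1.
Qed.

(** A shift by two places keeps the signs of the jumps, and the three entries at 0 in places 0, 1, 2
    weigh 1 - 2 + 2 = 1 together, so the step function is unchanged. *)
Lemma drop_pair_energy t i : breaks t -> (0 < i < 5)%N -> t i = t i.+1 ->
  energy (drop_pair t i) = energy t.
Proof.
move=> [t0 _ _]; move: i => [|[|[|[|[|i]]]]] //= _ tE;
  rewrite /energy !big_ord_recl !big_ord0 /wt /= /bump /drop_pair /=;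
  rewrite !addn0 !add1n /= -?tE; ring.
Qed.

Lemma drop_pair_nonzeros t i : breaks t -> (0 < i < 5)%N -> t i = t i.+1 -> t i != 0 ->
  (nonzeros (drop_pair t i) < nonzeros t)%N.
Proof.
move=> [t0 _ _]; move: i => [|[|[|[|[|i]]]]] //= _ tE tn0;
  rewrite /nonzeros !big_ord_recl !big_ord0 /= /bump /drop_pair /=;
  rewrite !addn0 !add1n /= ?subSS ?subn0 -?tE tn0 t0 eqxx /=; lia.
Qed.

(* A breakpoint at 1 is void; one at 0 reverses the sign of the step function,
   which does not affect the energy. *)
Lemma drop_last_energy t : breaks t -> t 5%N = 1 -> energy (t \o predn) = energy t.
Proof.
move=> tb t51.
rewrite /energy !big_ord_recl !big_ord0 /wt /= /bump /= !addn0 !add1n /= t51.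
have z i : (i < 6)%N -> corner 1 (t i) = 0 :> R.
  by move=> i6; apply: corner_right; exact: breaks_ge0.
have z' i : (i < 6)%N -> corner (t i) 1 = 0 :> R.
  by move=> i6; apply: corner_top; rewrite breaks_ge0 ?breaks_le1.
rewrite !z// !z'// (corner_right ler01).
ring.
Qed.

(** A coincidence away from 0, or a breakpoint at 1, can be traded for an equivalent minimizer with
    fewer nonzero breakpoints. Otherwise every nonzero breakpoint has room on both sides, and its
    slope vanishes. *)
Lemma minimizer_bound t : minimizer t -> - (10 / 137) <= energy t.
Proof.
have [n] := ubnP (nonzeros t); elim: n t => // n IH t; rewrite ltnS => tn [tb tmin].
have min_of u : breaks u -> energy u = energy t -> minimizer u.
  by move=> ub uE; split => // w wb; rewrite uE; exact: tmin.
have [/existsP[[i i5] /= /and3P[i0 /eqP tE tn0]]|/existsPn nopair] :=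
    boolP [exists i : 'I_5, [&& (0 < i)%N, t i == t i.+1 & t i != 0]].
  have i05 : (0 < i < 5)%N by rewrite i0.
  have uE := drop_pair_energy tb i05 tE.
  rewrite -uE; apply: IH; last exact: min_of (drop_pair_breaks tb i05) uE.
  exact: leq_trans (drop_pair_nonzeros tb i05 tE tn0) tn.
have [t51|t51] := eqVneq (t 5%N) 1.
  have uE := drop_last_energy tb t51; have [t0 tS t5] := tb.
  rewrite -uE; apply: IH; last first.
    apply: min_of => //; split => //= [[|i] i5|]; rewrite ?t0//=.
      by apply: tS; exact: ltnW.
    exact: breaks_le1.
  apply: leq_trans tn; rewrite /nonzeros !big_ord_recl !big_ord0 /= /bump /= !addn0 !add1n /=.
  by rewrite t51 oner_eq0 t0 eqxx !add0n /=; lia.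
apply: energy_critical => // i /andP[i0 i6].
have [ti0|tin0] := eqVneq (t i) 0; first exact: slope_at0.
have [t0 tS t5] := tb.
have lt_prev : t i.-1 < t i.
  rewrite lt_neqAle; apply/andP; split; last by rewrite -[in leRHS](prednK i0) tS; lia.
  have i15 : (i.-1 < 5)%N by lia.
  have [i1|i1] := posnP i.-1; first by rewrite i1 t0 eq_sym.
  have := nopair (Ordinal i15); rewrite /= i1 /= (prednK i0).
  by case: eqP => //= ->; rewrite tin0.
(* The last breakpoint is bounded on the right by the endpoint 1. *)
pose nxt := if i == 5%N then 1 else t i.+1.
have lt_next : t i < nxt.
  rewrite /nxt; case: eqP => [->|i5]; first by rewrite lt_neqAle t51.
  have i5' : (i < 5)%N by lia.
  rewrite lt_neqAle tS// andbT.
  by have := nopair (Ordinal i5'); rewrite /= i0 tin0 andbT.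
pose e := Num.min (t i - t i.-1) (nxt - t i).
apply: (minimizer_slope (e := e)) => //; first by rewrite lt_min !subr_gt0 lt_prev.
move=> h; rewrite le_min !ler_norml => /andP[/andP[h1 h2] /andP[h3 h4]].
rewrite /shift; split.
- by rewrite t0 (_ : (0 == i)%N = false) ?mulr0 ?addr0//; lia.
- move=> j j5; have tj := tS j j5.
  have [ji|ji] := eqVneq j i.
    rewrite (_ : (j.+1 == i) = false) ?mulr0 ?mulr1 ?addr0; last by lia.
    move: h4; rewrite /nxt -ji (_ : (j == 5) = false); last by lia.
    by lra.
  rewrite mulr0 addr0; have [ji1|_] := eqVneq j.+1 i; last by rewrite mulr0 addr0.
  by move: h1; rewrite -ji1 /= mulr1; lra.
- have [i5|i5] := eqVneq 5%N i; last by rewrite mulr0 addr0.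
  by move: h4; rewrite /nxt -i5 eqxx mulr1; lra.
Qed.

Lemma energy_ge t : breaks t -> - (10 / 137) <= energy t.
Proof.
move=> tb; have [u umin] := minimizer_exists.
exact: le_trans (minimizer_bound umin) (umin.2 t tb).
Qed.

End Descent.

(** * Lattice approximation *)

Section Lattice.
Variable R : realFieldType.

Lemma count_half (n d m : nat) : (m <= n.*2)%N ->
  (\sum_(l < n) ((d <= l) && (l.*2 < m)))%N = (uphalf m - d)%N.
Proof.
move=> mn; have H p : (\sum_(l < p) ((d <= l) && (l.*2 < m)) = minn (uphalf m) p - d)%N.
  elim: p => [|p IH]; first by rewrite big_ord0 minn0 sub0n.
  rewrite big_ord_recr /= IH uphalf_half; have := odd_double_half m; rewrite -!addnn.
  by case: (odd m) => /=; case: leqP => /=; case: ltnP => /=; lia.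
rewrite H; congr (_ - _)%N; apply/minn_idPl.
by rewrite uphalf_half; have := odd_double_half m; case: (odd m) => /=; lia.
Qed.

Lemma uphalf_sub_hinge (m d : nat) :
  `|(uphalf m - d)%N%:R - hinge (m%:R / 2 - d%:R) : R| <= 2^-1.
Proof.
have mE : m%:R = (odd m)%:R + m./2%:R * 2 :> R.
  by rewrite -[in LHS](odd_double_half m) natrD -muln2 natrM.
rewrite uphalf_half mE; have [dm|md] := leqP d (odd m + m./2).
  rewrite natrB// natrD; have : d%:R <= (odd m + m./2)%:R :> R by rewrite ler_nat.
  rewrite natrD; case: (odd m) => /= dm'; rewrite ler_norml;
    case: hingeP => ?; apply/andP; split; lra.
rewrite (eqP (ltnW md : (_ - _ == 0)%N)).
have : (odd m + m./2)%:R <= d%:R :> R by rewrite ler_nat ltnW.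
by rewrite natrD; case: (odd m) => /= dm'; rewrite ler_norml;
    case: hingeP => ?; apply/andP; split; lra.
Qed.

(** The indicator of n - k <= 2l < n + k, the lattice form of the band, kept as same-half pairs
    minus opposite-half pairs. *)
Definition kernel (n k l : nat) : R := (l.*2 < n + k)%N%:R - (l.*2 + k < n)%N%:R.

Lemma hinge_scale (a u : R) : 0 <= a -> hinge (a * u) = a * hinge u.
Proof.
move=> a0; case: (hingeP u) => u0; first by rewrite hinge_id// mulr_ge0.
by rewrite mulr0 hinge_eq0// mulr_ge0_le0.
Qed.

(** Summation replaces integration in x. The induction uses [maxn m b] because the partial sum stays
    empty until m passes b. *)
Lemma telescope_approx (P r : nat -> R) (e : R) (b n : nat) : (b <= n)%N -> 0 <= e ->
  (forall k, (k < n)%N -> `|P k.+1 - P k - r k| <= e) ->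
  `|\sum_(k < n) (b <= k)%N%:R * r k - (P n - P b)| <= e * n%:R.
Proof.
move=> bn e0 Pr; have H m : (m <= n)%N ->
    `|\sum_(k < m) (b <= k)%N%:R * r k - (P (maxn m b) - P b)| <= e * m%:R.
  elim: m => [_|m IH mn]; first by rewrite big_ord0 max0n subrr subr0 normr0 mulr0.
  rewrite big_ord_recr /= -natr1 mulrDr mulr1; have {IH} := IH (ltnW mn).
  have [bm|mb] := leqP b m.
    have -> : maxn m.+1 b = m.+1 by lia.
    rewrite mul1r.
    have := Pr _ mn; rewrite !ler_norml => /andP[? ?] /andP[? ?].
    by apply/andP; split; lra.
  have -> : maxn m.+1 b = b by lia.
  rewrite mul0r addr0 => IH.
  by apply: le_trans IH _; rewrite lerDl.
by have := H n (leqnn n); rewrite (maxn_idPl bn).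
Qed.

(** Row k contains [r k] admissible l, and [P] is a primitive of the row length. Each row errs by at
    most 3/2: 1/2 for each of two rounded counts and 1/4 for each of two Taylor remainders. *)
Lemma corner_count (n b d : nat) : (0 < n)%N -> (b <= n)%N ->
  `|\sum_(k < n) \sum_(l < n) (b <= k)%N%:R * (d <= l)%N%:R * kernel n k l
    - n%:R ^+ 2 * corner (b%:R / n%:R) (d%:R / n%:R)| <= 2 * n%:R.
Proof.
move=> n0 bn; have nR : n%:R != 0 :> R by rewrite pnatr_eq0 -lt0n.
pose P k : R := hinge ((n%:R + k%:R) / 2 - d%:R) ^+ 2 + hinge ((n%:R - k%:R) / 2 - d%:R) ^+ 2.
pose r k : R := (uphalf (n + k) - d)%N%:R - (uphalf (n - k) - d)%N%:R.
have -> : \sum_(k < n) \sum_(l < n) (b <= k)%N%:R * (d <= l)%N%:R * kernel n k l =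
    \sum_(k < n) (b <= k)%N%:R * r k.
  apply: eq_bigr => k _; under eq_bigr do rewrite -mulrA.
  rewrite -mulr_sumr; congr (_ * _); rewrite /r.
  rewrite -(@count_half n) -?(@count_half n d (n - k)); try by have := ltn_ord k; lia.
  rewrite !natr_sum -sumrB; apply: eq_bigr => l _; rewrite /kernel mulrBr -!natrM !mulnb.
  by congr (_ - (_ && _)%:R); have := ltn_ord k; lia.
have -> : n%:R ^+ 2 * corner (b%:R / n%:R) (d%:R / n%:R) = P n - P b.
  have hs u v : n%:R * u = v -> n%:R ^+ 2 * hinge u ^+ 2 = hinge v ^+ 2 :> R.
    by move=> <-; rewrite hinge_scale// exprMn.
  rewrite /corner /P !mulrBr.
  rewrite (hs _ (n%:R - d%:R)); last by field.
  rewrite (hs _ ((n%:R + b%:R) / 2 - d%:R)); last by field.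
  rewrite (hs _ ((n%:R - b%:R) / 2 - d%:R)); last by field.
  rewrite (_ : (n%:R + n%:R) / 2 = n%:R); last by field.
  rewrite subrr mul0r sub0r (@hinge_eq0 _ (- d%:R)) ?oppr_le0//.
  by rewrite expr0n /=; ring.
apply: telescope_approx => // k kn; rewrite /P /r.
have := uphalf_sub_hinge (n + k) d; have := uphalf_sub_hinge (n - k) d.
rewrite natrD (natrB R (ltnW kn)) -[k.+1%:R]natr1.
have -> : (n%:R + (k%:R + 1)) / 2 - d%:R = (n%:R + k%:R) / 2 - d%:R + 2^-1 :> R by field.
have -> : (n%:R - (k%:R + 1)) / 2 - d%:R = (n%:R - k%:R) / 2 - d%:R + - 2^-1 :> R by field.
have := hinge_taylor ((n%:R + k%:R) / 2 - d%:R : R) 2^-1.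
have := hinge_taylor ((n%:R - k%:R) / 2 - d%:R : R) (- 2^-1).
rewrite sqrrN (_ : 2^-1 ^+ 2 = 4^-1 :> R); last by field.
rewrite !ler_norml => /andP[? ?] /andP[? ?] /andP[? ?] /andP[? ?].
by apply/andP; split; lra.
Qed.

Definition step (b : nat -> nat) (k : nat) : R := \sum_(i < 6) wt R i * (b i <= k)%N%:R.

Lemma step_sum_approx (n : nat) (b : nat -> nat) : (0 < n)%N ->
  (forall i, (i < 6)%N -> (b i <= n)%N) ->
  `|\sum_(k < n) \sum_(l < n) step b k * step b l * kernel n k l
    - n%:R ^+ 2 * energy (fun i => (b i)%:R / n%:R)| <= 288 * n%:R.
Proof.
move=> n0 bn.
have -> : \sum_(k < n) \sum_(l < n) step b k * step b l * kernel n k l =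
    \sum_(i < 6) \sum_(j < 6) wt R i * wt R j *
      \sum_(k < n) \sum_(l < n) (b i <= k)%N%:R * (b j <= l)%N%:R * kernel n k l.
  transitivity (\sum_(k < n) \sum_(l < n) \sum_(i < 6) \sum_(j < 6)
      wt R i * wt R j * ((b i <= k)%N%:R * (b j <= l)%N%:R * kernel n k l)).
    apply: eq_bigr => k _; apply: eq_bigr => l _; rewrite /step mulr_suml mulr_suml.
    apply: eq_bigr => i _; rewrite mulr_sumr mulr_suml; apply: eq_bigr => j _; ring.
  under eq_bigr => k _ do rewrite exchange_big /=.
  rewrite exchange_big /=; apply: eq_bigr => i _.
  under eq_bigr => k _ do rewrite exchange_big /=.
  rewrite exchange_big /=; apply: eq_bigr => j _.
  by rewrite mulr_sumr; apply: eq_bigr => k _; rewrite mulr_sumr.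
rewrite /energy mulr_sumr -sumrB; apply: le_trans (ler_norm_sum _ _ _) _.
have -> : 288 * n%:R = \sum_(i < 6) 48 * n%:R :> R.
  by rewrite sumr_const card_ord -mulrnAl -mulr_natr; congr (_ * _); ring.
apply: ler_sum => i _; rewrite mulr_sumr -sumrB; apply: le_trans (ler_norm_sum _ _ _) _.
have -> : 48 * n%:R = \sum_(i < 6) 8 * n%:R :> R.
  by rewrite sumr_const card_ord -mulrnAl -mulr_natr; congr (_ * _); ring.
apply: ler_sum => j _; rewrite mulrCA -mulrBr !normrM.
have -> : 8 * n%:R = 2 * 2 * (2 * n%:R) :> R by ring.
apply: ler_pM; rewrite ?mulr_ge0//; first by apply: ler_pM; rewrite ?wt_abs.
by apply: corner_count => //; exact: bn.
Qed.

End Lattice.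

(** * Counting 3-APs through signs *)

Section CountAP.
Variables (R : realFieldType) (N : nat).

Lemma ap3E (t : 'I_N * 'I_N * 'I_N) : (t \in ap3 N) = (t.1.1 + t.2 == t.1.2.*2)%N.
Proof.
rewrite inE; move: t => [[x y] z] /=; apply/asboolP/eqP => [[d [h1 h2]]|h].
  have {}h1 : Posz y.+1 = Posz x.+1 + d :> int := h1.
  have {}h2 : Posz z.+1 = Posz x.+1 + (d + d) :> int by rewrite h2 mulrDl mul1r.
  by lia.
exists (Posz y - Posz x); rewrite mulrDl mul1r; split.
  by have : Posz y.+1 = Posz x.+1 + (Posz y - Posz x) :> int by lia.
by have : Posz z.+1 = Posz x.+1 + (Posz y - Posz x + (Posz y - Posz x)) :> int by lia.
Qed.

Lemma card_triples (P : pred ('I_N * 'I_N * 'I_N)) :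
  #|[set t | P t]%SET|%:R = \sum_(x < N) \sum_(y < N) \sum_(z < N) (P (x, y, z))%:R :> R.
Proof.
rewrite -sum1_card natr_sum (eq_bigl P) => [|t]; last by rewrite inE.
rewrite big_mkcond /= pair_bigA /= pair_bigA /=.
by apply: eq_bigr => -[[x y] z] _ /=; case: ifP.
Qed.

Lemma sum_indicator (m : nat) : \sum_(z < N) (z == m :> nat)%:R = (m < N)%N%:R :> R.
Proof.
have [mN|Nm] := ltnP m N; last first.
  by rewrite big1// => z _; rewrite (_ : _ == _ = false)//; have := ltn_ord z; lia.
rewrite (bigD1 (Ordinal mN)) //= eqxx big1 ?addr0// => z zm.
by rewrite -val_eqE /= in zm; rewrite (negPf zm).
Qed.

Lemma sum_last (x y : nat) :
  \sum_(z < N) (x + z == y.*2)%N%:R = (x <= y.*2 < x + N)%N%:R :> R.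
Proof.
have [xy|yx] := leqP x y.*2; last first.
  by rewrite big1// => z _; rewrite (_ : _ == _ = false)//; lia.
rewrite (_ : (y.*2 < x + N)%N = (y.*2 - x < N)%N) -?sum_indicator; last by lia.
by apply: eq_bigr => z _; congr (_%:R); lia.
Qed.

Lemma sum_middle (x z : 'I_N) :
  \sum_(y < N) (x + z == y.*2)%N%:R = (odd x == odd z)%:R :> R.
Proof.
have [e|ne] := boolP (odd x == odd z); last first.
  rewrite big1// => y _; rewrite (_ : (_ == _)%N = false)//; apply/negbTE.
  by apply: contra ne => /eqP /(congr1 odd); rewrite oddD odd_double; do 2 case: odd.
have -> : true%:R = ((x + z)./2 < N)%N%:R :> R.
  by congr (_%:R); have := ltn_ord x; have := ltn_ord z; lia.
rewrite -sum_indicator; apply: eq_bigr => y _; congr (_%:R).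
by have := eqP e; lia.
Qed.

(** A 3-AP is given by its first two terms x, y, provided 2y - x is in range, or by its first and
    last terms, which have equal parity. These two descriptions give T and X. *)
Definition pair_sum (s : nat -> R) : R :=
  \sum_(x < N) \sum_(y < N) (x <= y.*2 < x + N)%N%:R * (s x * s y).

Definition parity_sum (s : nat -> R) : R :=
  \sum_(x < N) \sum_(z < N) (odd x == odd z)%:R * (s x * s z).

Lemma card_ap3 : #|ap3 N|%:R = parity_sum (fun=> 1).
Proof.
rewrite /ap3 (card_triples (fun t => `[< is_ap3 t.1.1 t.1.2 t.2 >])).
apply: eq_bigr => x _; rewrite exchange_big /=; apply: eq_bigr => z _.
rewrite !mulr1 -sum_middle; apply: eq_bigr => y _; congr (_%:R).
by have := ap3E (x, y, z); rewrite inE /= => ->.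
Qed.

(** Extended by [false] outside the range, so that index arithmetic takes place in nat. *)
Definition col (c : coloring N) (x : nat) : bool := oapp c false (insub x).

Lemma colE (c : coloring N) (i : 'I_N) : col c i = c i.
Proof. by rewrite /col valK. Qed.

Definition sgn (c : coloring N) (x : nat) : R := (-1) ^+ col c x.

(** For signs, 1 + s_x s_y + s_z s_y + s_x s_z is 4 if all three agree and 0 otherwise. Reversing
    the progression identifies the two sums that involve the middle term. *)
Lemma m3_sum (c : coloring N) :
  4 * (m3 c)%:R = #|ap3 N|%:R + 2 * pair_sum (sgn c) + parity_sum (sgn c).
Proof.
pose ap (x y z : 'I_N) : R := (x + z == y.*2)%N%:R.
have -> : 4 * (m3 c)%:R = \sum_(x < N) \sum_(y < N) \sum_(z < N)
    (ap x y z + ap x y z * (sgn c x * sgn c y) + ap x y z * (sgn c z * sgn c y)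
     + ap x y z * (sgn c x * sgn c z)).
  rewrite /m3 (card_triples (fun t => (t \in ap3 N) &&
    ((c t.1.1 == c t.1.2) && (c t.1.2 == c t.2)))).
  do 3 (rewrite mulr_sumr; apply: eq_bigr => ? _).
  rewrite ap3E /ap /sgn !colE /=.
  by case: (_ == _); case: (c _); case: (c _); case: (c _) => /=; ring.
under eq_bigr => x _ do under eq_bigr => y _ do rewrite !big_split.
under eq_bigr => x _ do rewrite !big_split.
rewrite !big_split /=; congr (_ + _); last first.
  apply: eq_bigr => x _; rewrite exchange_big /=; apply: eq_bigr => z _.
  by rewrite -mulr_suml sum_middle.
rewrite -addrA; congr (_ + _).
  rewrite card_ap3; apply: eq_bigr => x _; rewrite exchange_big /=.
  by apply: eq_bigr => z _; rewrite sum_middle !mulr1.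
have TE : \sum_(x < N) \sum_(y < N) \sum_(z < N) ap x y z * (sgn c x * sgn c y) =
    pair_sum (sgn c).
  by apply: eq_bigr => x _; apply: eq_bigr => y _; rewrite -mulr_suml sum_last.
rewrite TE mulrDl !mul1r; congr (_ + _); rewrite -TE.
under eq_bigr => x _ do rewrite exchange_big /=.
rewrite exchange_big /=; apply: eq_bigr => x _; rewrite exchange_big /=.
by apply: eq_bigr => y _; apply: eq_bigr => z _; rewrite /ap addnC.
Qed.

(** The indicator of equal parity is (1 + (-1)^(x + z))/2, and each half factors as a square. *)
Lemma parity_sumE (s : nat -> R) : parity_sum s =
  ((\sum_(x < N) s x) ^+ 2 + (\sum_(x < N) (-1) ^+ x * s x) ^+ 2) / 2.
Proof.
rewrite !expr2 !mulr_suml -big_split mulr_suml; apply: eq_bigr => x _ /=.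
rewrite !mulr_sumr -big_split mulr_suml; apply: eq_bigr => z _ /=.
have sE (m : nat) : (-1) ^+ m = (-1) ^+ odd m :> R by rewrite signr_odd.
rewrite (sE x) (sE z).
by case: (odd x); case: (odd z) => /=; field.
Qed.

Lemma alternating_sum : \sum_(x < N) (-1) ^+ x = (odd N)%:R :> R.
Proof.
elim: N => [|n IH]; first by rewrite big_ord0.
by rewrite big_ord_recr /= IH -signr_odd; case: (odd n) => /=; ring.
Qed.

Lemma card_ap3E : #|ap3 N|%:R = (N%:R ^+ 2 + (odd N)%:R) / 2 :> R.
Proof.
rewrite card_ap3 parity_sumE sumr_const card_ord.
under [X in _ + X ^+ 2]eq_bigr do rewrite mulr1.
by rewrite alternating_sum; case: (odd N); rewrite ?expr1n// expr0n.
Qed.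

(** The index k counts outward from the centre, so mirror images share the same k. *)
Lemma sum_halves (F : nat -> R) :
  \sum_(x < N) F x = \sum_(k < N./2) (F (N./2 - k.+1)%N + F (N./2 + odd N + k)%N)
    + (odd N)%:R * F N./2.
Proof.
rewrite -(big_mkord xpredT F) -[N in LHS](odd_double_half N) addnC -addnn.
rewrite -addnA (big_cat_nat (n := N./2)) ?leq_addr//=.
rewrite big_split /= -addrA; congr (_ + _).
  rewrite big_nat_rev /= add0n big_mkord; apply: eq_bigr => k _; congr F; lia.
rewrite (big_cat_nat (n := N./2 + odd N)) ?leq_addr//=; last by lia.
rewrite addrC; congr (_ + _).
  rewrite -[X in \sum_(X <= _ < _) _]add0n big_addn.
  rewrite (_ : (_ - _ = N./2)%N); last by lia.
  by rewrite big_mkord; apply: eq_bigr => k _; congr F; lia.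
case: (odd N) => /=; last by rewrite addn0 big_geq// mul0r.
by rewrite addn1 big_nat1 mul1r.
Qed.

End CountAP.

(* The values of an anti-symmetric sequence on the right half determine the pair
   sum up to the terms that involve the middle element. *)
Lemma pair_sum_fold (R : realFieldType) (N : nat) (s g : nat -> R) :
  (forall x, (x < N)%N -> `|s x| <= 1) ->
  (forall k, (k < N./2)%N -> s (N./2 + odd N + k)%N = g k) ->
  (forall k, (k < N./2)%N -> s (N./2 - k.+1)%N = - g k) ->
  `|pair_sum N s - 2 * \sum_(k < N./2) \sum_(l < N./2) g k * g l * kernel R N./2 k l|
    <= 4 * N%:R.
Proof.
move=> s1 sR sL; have Ne := odd_double_half N; rewrite -addnn in Ne.
set n := N./2 in sR sL Ne *; set e := nat_of_bool (odd N) in sR sL Ne *.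
have e1 : (e <= 1)%N by rewrite /e; case: (odd N).
pose F x y : R := (x <= y.*2 < x + N)%N%:R * (s x * s y).
have F1 x y : (x < N)%N -> (y < N)%N -> `|F x y| <= 1.
  move=> xN yN; rewrite /F !normrM normr_nat; case: (_ && _) => /=; last by rewrite mul0r.
  by rewrite mul1r; apply: mulr_ile1; rewrite ?s1.
have g1 k : (k < n)%N -> `|g k| <= 1.
  by move=> kn; rewrite -sR// s1//; lia.
(* For odd N, [E1] collects the pairs with y in the middle and [E2] the remaining pairs with x in
   the middle. *)
pose E1 := \sum_(x < N) F x n.
pose E2 := \sum_(l < n) (F n (n - l.+1)%N + F n (n + e + l)%N).
have -> : pair_sum N s = \sum_(k < n) \sum_(l < n)
    2 * (g k * g l * ((l.*2 < n + k)%N%:R - (l.*2 + k + 2 + e <= n)%N%:R))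
    + e%:R * (E1 + E2).
  have -> : pair_sum N s = \sum_(x < N) (\sum_(l < n) (F x (n - l.+1)%N + F x (n + e + l)%N)
      + e%:R * F x n).
    by apply: eq_bigr => x _; rewrite -/n -/e -(sum_halves N (F x)).
  rewrite big_split /= -mulr_sumr mulrDr [e%:R * E1 + _]addrC addrA; congr (_ + _).
  rewrite (sum_halves N (fun x => \sum_(l < n) (F x (n - l.+1)%N + F x (n + e + l)%N))).
  congr (_ + _); apply: eq_bigr => k _; rewrite -big_split /=; apply: eq_bigr => l _.
  have kn := ltn_ord k; have ln := ltn_ord l.
  rewrite /F -/n -/e !sL// !sR//.
  have -> : (n - k.+1 <= (n - l.+1).*2 < n - k.+1 + N)%N = (l.*2 < n + k)%N by lia.
  have -> : (n - k.+1 <= (n + e + l).*2 < n - k.+1 + N)%N = (l.*2 + k + 2 + e <= n)%N by lia.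
  have -> : (n + e + k <= (n - l.+1).*2 < n + e + k + N)%N = (l.*2 + k + 2 + e <= n)%N by lia.
  have -> : (n + e + k <= (n + e + l).*2 < n + e + k + N)%N = (l.*2 < n + k)%N by lia.
  by ring.
have -> : \sum_(k < n) \sum_(l < n)
    2 * (g k * g l * ((l.*2 < n + k)%N%:R - (l.*2 + k + 2 + e <= n)%N%:R))
    + e%:R * (E1 + E2) - 2 * (\sum_(k < n) \sum_(l < n) g k * g l * kernel R n k l) =
  2 * (\sum_(l < n) \sum_(k < n) g k * g l *
    ((l.*2 + k < n)%N%:R - (l.*2 + k + 2 + e <= n)%N%:R)) + e%:R * (E1 + E2).
  rewrite addrAC; congr (_ + _); rewrite [in RHS]exchange_big /= !mulr_sumr -sumrB.
  apply: eq_bigr => k _; rewrite !mulr_sumr -sumrB; apply: eq_bigr => l _.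
  by rewrite /kernel; ring.
apply: le_trans (ler_normD _ _) _.
(* The first part pays for the correction of the kernel, the second for [E1], at most N, and [E2],
   at most 2n. *)
have -> : 4 * N%:R = 2 * (\sum_(l < n) 2) + 2 * (N%:R + N%:R - n%:R * 2) :> R.
  by rewrite sumr_const card_ord -mulr_natr; ring.
apply: lerD.
  rewrite normrM ger0_norm// ler_pM2l//; apply: le_trans (ler_norm_sum _ _ _) _.
  apply: ler_sum => l _; apply: le_trans (ler_norm_sum _ _ _) _.
  (* The two indicators of opposite-half pairs can differ only if n - 2l - k is 1 or 2, that is for
     at most two k. *)
  apply: (@le_trans _ _ (\sum_(k < n) ((k == (n - l.*2.+1)%N :> nat)%:R
      + (k == (n - l.*2.+2)%N :> nat)%:R))).
    apply: ler_sum => k _; rewrite !normrM -[leRHS]mul1r; apply: ler_pM => //.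
      by apply: mulr_ile1; rewrite ?g1.
    have [h1|h1] := ltnP (l.*2 + k)%N n; have [h2|h2] := leqP (l.*2 + k + 2 + e)%N n;
      rewrite ?subrr ?normr0 ?addr_ge0// ?subr0 ?sub0r ?normrN normr1; last by lia.
    have [->|ne1] := eqVneq (k : nat) (n - l.*2.+1)%N; first by rewrite lerDl.
    rewrite (_ : (k == (n - l.*2.+2)%N :> nat)) ?add0r//; lia.
  rewrite big_split /= !sum_indicator; do 2 case: (_ < _)%N; rewrite /=; lra.
have NE : N%:R = n%:R + n%:R + e%:R :> R by rewrite -!natrD; congr (_%:R); lia.
have [e0|ee] : e = 0%N \/ e = 1%N by lia.
  rewrite e0 in NE *; rewrite mul0r normr0 mulr_ge0//.
  by have n0 : 0 <= n%:R :> R by []; lra.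
rewrite ee in NE *; rewrite mul1r; apply: le_trans (ler_normD _ _) _.
have hE1 : `|E1| <= N%:R.
  apply: le_trans (ler_norm_sum _ _ _) _.
  rewrite -[N in leRHS]card_ord -sumr_const; apply: ler_sum => x _.
  by apply: F1 => //; lia.
have hE2 : `|E2| <= n%:R * 2.
  apply: le_trans (ler_norm_sum _ _ _) _.
  have -> : n%:R * 2 = \sum_(l < n) 2 :> R by rewrite sumr_const card_ord -[RHS]mulr_natl.
  apply: ler_sum => l _; have ln := ltn_ord l; apply: le_trans (ler_normD _ _) _.
  have h1 : `|F n (n - l.+1)%N| <= 1 by apply: F1; lia.
  have h2 : `|F n (n + e + l)%N| <= 1 by apply: F1; lia.
  by lra.
by have n0 : 0 <= n%:R :> R by []; lra.
Qed.

(** * Blocks and color changes *)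

Definition changes (f : nat -> bool) (x : nat) : nat := (\sum_(i < x) (f i != f i.+1))%N.

Lemma changesS f x : changes f x.+1 = (changes f x + (f x != f x.+1))%N.
Proof. by rewrite /changes big_ord_recr. Qed.

Lemma changesD f x y :
  changes f (x + y) = (changes f x + changes (fun k => f (x + k)) y)%N.
Proof. by rewrite /changes big_split_ord; congr (_ + _)%N; under eq_bigr do rewrite /= -addnS. Qed.

Lemma changes_mono f x y : (x <= y)%N -> (changes f x <= changes f y)%N.
Proof. by move=> xy; rewrite -(subnKC xy) changesD leq_addr. Qed.

Lemma odd_changes f x : f x = f 0%N (+) odd (changes f x).
Proof.
elim: x => [|x IH]; first by rewrite /changes big_ord0 addbF.
by rewrite changesS oddD addbA -IH oddb; case: (f x); case: (f x.+1).
Qed.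

Lemma changes_const f x y :
  (forall z, (x <= z <= y)%N -> f z = f x) -> (x <= y)%N -> changes f y = changes f x.
Proof.
move=> fz xy; rewrite -(subnKC xy) changesD /changes [X in (_ + X)%N]big1 ?addn0// => i _.
have := ltn_ord i => iyx.
by rewrite !fz ?eqxx//; lia.
Qed.

(** A discrete intermediate value theorem: the count starts at 0 and grows by at most 1 per step. *)
Lemma changes_onto f m v : (v <= changes f m)%N -> exists2 x, (x <= m)%N & changes f x = v.
Proof.
elim: m => [|m IH]; first by rewrite {1}/changes big_ord0 leqn0 => /eqP ->; exists 0%N;
  rewrite // /changes big_ord0.
rewrite changesS => vm; have [/IH[x xm <-]|mv] := leqP v (changes f m).
  by exists x => //; exact: leqW.
exists m.+1 => //; rewrite changesS.
by move: vm; case: (_ != _) => /=; lia.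
Qed.

Section Blocks.
Variables (N : nat) (c : coloring N).
Let f := col c.

(** The count of changes is monotone and constant along each run, so its fibres are exactly the
    blocks. *)
Definition level (v : nat) : {set 'I_N} := [set i : 'I_N | changes f i == v]%SET.

Lemma run_level B (x : 'I_N) : monochromatic_run c B -> x \in B ->
  B \subset level (changes f x).
Proof.
move=> /and3P[_ /forall_inP conv /forall_inP mono] xB.
have ltE (y z : 'I_N) : y \in B -> z \in B -> (y <= z)%N -> changes f z = changes f y.
  move=> yB zB yz; apply: changes_const => // w /andP[yw wz].
  have wN : (w < N)%N by exact: leq_ltn_trans (ltn_ord z).
  have wB : Ordinal wN \in B.
    move/forall_inP : (conv y yB) => /(_ z zB) /forallP /(_ (Ordinal wN)) /implyP.
    by apply; rewrite /= yw.
  rewrite /f (colE c (Ordinal wN)) (colE c y).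
  by apply/eqP; move/forall_inP : (mono _ wB) => /(_ y yB).
apply/fintype.subsetP => y yB; rewrite inE; apply/eqP.
by have [xy|/ltnW yx] := leqP x y; [|apply/esym]; apply: ltE.
Qed.

Lemma level_run (x : 'I_N) : monochromatic_run c (level (changes f x)).
Proof.
apply/and3P; split.
- by apply/set0Pn; exists x; rewrite inE.
- apply/forall_inP => y; rewrite inE => /eqP yx; apply/forall_inP => z; rewrite inE => /eqP zx.
  apply/forallP => w; apply/implyP => /andP[yw wz]; rewrite inE eqn_leq.
  by rewrite -{1}zx -{1}yx !changes_mono.
- apply/forall_inP => y; rewrite inE => /eqP yx; apply/forall_inP => z; rewrite inE => /eqP zx.
  by rewrite -(colE c y) -(colE c z) -/f (odd_changes f y) (odd_changes f z) yx zx.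
Qed.

Lemma blocksE : (0 < N)%N ->
  blocks c = [set level (v : nat) | v : 'I_(changes f N.-1).+1]%SET.
Proof.
move=> N0; apply/setP => B; rewrite inE; apply/idP/imsetP => [/maxsetP[runB maxB]|[v _ ->]].
  have /and3P[/set0Pn[x xB] _ _] := runB.
  have xv : (changes f x < (changes f N.-1).+1)%N.
    by rewrite ltnS changes_mono//; have := ltn_ord x; lia.
  by exists (Ordinal xv) => //; rewrite (maxB _ (level_run x))//; exact: run_level.
have [x xN xv] := changes_onto (ltn_ord v : (v <= _)%N).
have xN' : (x < N)%N by lia.
rewrite -xv -[x]/(val (Ordinal xN')); apply/maxsetP; split; first exact: level_run.
move=> C runC levC; apply/eqP; rewrite finset.eqEsubset levC andbT; apply: run_level => //.
by apply: (fintype.subsetP levC); rewrite inE.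
Qed.

Lemma card_blocks : (0 < N)%N -> #|blocks c| = (changes f N.-1).+1.
Proof.
move=> N0; rewrite blocksE// card_imset ?card_ord// => v w vw; apply/val_inj => /=.
have [x xN xv] := changes_onto (ltn_ord v : (v <= _)%N).
have xN' : (x < N)%N by lia.
have : Ordinal xN' \in level v by rewrite inE xv.
by rewrite vw inE /= xv => /eqP.
Qed.

End Blocks.

(** Reflection and complementation preserve changes, so both halves contribute equally. The centre
    joins opposite colors in one step, or in two steps through a middle element of either color, and
    so contributes exactly one change. *)
Lemma changes_anti (f g : nat -> bool) (n : nat) (e : bool) : (0 < n)%N ->
  (forall k, (k < n)%N -> f (n + e + k)%N = g k) ->
  (forall k, (k < n)%N -> f (n - k.+1)%N = ~~ g k) ->
  changes f (n.-1 + e.+1 + n.-1) = (changes g n.-1).*2.+1.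
Proof.
move=> n0 fR fL; rewrite !changesD.
have -> : changes f n.-1 = changes g n.-1.
  rewrite /changes (reindex_inj rev_ord_inj) /=; apply: eq_bigr => i _.
  have i1 := ltn_ord i.
  have -> : (n.-1 - i.+1 = n - i.+1.+1)%N by lia.
  have -> : ((n - i.+1.+1).+1 = n - i.+1)%N by lia.
  by rewrite !fL; [case: (g i); case: (g i.+1)|lia|lia].
have -> : changes (fun k => f (n.-1 + e.+1 + k)%N) n.-1 = changes g n.-1.
  apply: eq_bigr => i _; have i1 := ltn_ord i.
  have -> : (n.-1 + e.+1 + i = n + e + i)%N by lia.
  have -> : (n.-1 + e.+1 + i.+1 = n + e + i.+1)%N by lia.
  by rewrite !fR//; lia.
have -> : changes (fun k => f (n.-1 + k)%N) e.+1 = 1%N.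
  have f0 : f n.-1 = ~~ g 0%N by rewrite -fL//; congr f; lia.
  have := fR 0%N n0; rewrite addn0 => f1.
  case: e f1 {fR} => f1; rewrite /changes !big_ord_recl big_ord0 /bump /= ?addn0 ?add1n f0.
    have -> : (n.-1 + 2 = n + true)%N by lia.
    by rewrite f1; case: (f _); case: (g 0%N).
  have -> : (n.-1 + 1 = n + false)%N by lia.
  by rewrite f1; case: (g 0%N).
by rewrite -addnn; lia.
Qed.

Lemma anti_symmetricP N (c : coloring N) :
  reflect (forall k, (k < N./2)%N -> col c (N./2 - k.+1)%N = ~~ col c (N./2 + odd N + k)%N)
    (anti_symmetric c).
Proof.
have Ne := odd_double_half N; rewrite -addnn in Ne.
apply: (iffP forallP) => [anti k kn|anti i].
  have iN : (N./2 + odd N + k < N)%N by lia.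
  have := anti (Ordinal iN); rewrite -!colE /=.
  have -> : (N - (N./2 + odd N + k).+1 = N./2 - k.+1)%N by lia.
  rewrite -val_eqE /= (_ : (_ == _)%N = false) /=; last by lia.
  by case: (col _ _); case: (col _ _).
apply/implyP; rewrite -val_eqE /= -!colE /= => ne; have iN := ltn_ord i.
have [ilt|ige] := ltnP i N./2.
  have := anti (N./2 - i.+1)%N; rewrite (_ : (N./2 - (N./2 - i.+1).+1 = i)%N); last by lia.
  rewrite (_ : (N./2 + odd N + (N./2 - i.+1) = N - i.+1)%N); last by lia.
  by move=> ->; [case: (col _ _)|lia].
have := anti (i - (N./2 + odd N))%N.
rewrite (_ : (N./2 - (i - (N./2 + odd N)).+1 = N - i.+1)%N); last by move/eqP: ne; lia.
rewrite (_ : (N./2 + odd N + (i - (N./2 + odd N)) = i)%N); last by move/eqP: ne; lia.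
by move=> ->; [case: (col _ _)|move/eqP: ne; lia].
Qed.

(** With m changes in the right half there are 2m + 2 blocks, and 2m + 2 <= 12 means m <= 5. *)
Lemma Ctilde2P N (c : coloring N) : (1 < N)%N -> anti_symmetric c ->
  (c \in Ctilde2 N) = (changes (fun k => col c (N./2 + odd N + k)) N./2.-1 <= 5)%N.
Proof.
move=> N1 anti; rewrite inE anti /= card_blocks; last by lia.
have Ne := odd_double_half N; rewrite -addnn in Ne.
rewrite (_ : N.-1 = (N./2.-1 + (odd N).+1 + N./2.-1)%N); last by lia.
rewrite (@changes_anti _ (fun k => col c (N./2 + odd N + k)%N) N./2 (odd N))//; try by lia.
by move=> k kn; exact/anti_symmetricP.
Qed.

(** * Passage to the limit *)

Section Approximation.
Variable R : realFieldType.

Lemma sum_ltn (n m : nat) : (\sum_(j < n) (j < m))%N = minn m n.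
Proof.
elim: n => [|n IH]; first by rewrite big_ord0 minn0.
by rewrite big_ord_recr /= IH; case: ltnP => /=; lia.
Qed.

(* The position at which the [i]-th color change has taken place; [n] if there are
   fewer than [i] changes. *)
Definition change_pos (g : nat -> bool) (n i : nat) : nat :=
  (\sum_(k < n) (changes g k < i))%N.

(** By monotonicity the indices counted by [change_pos] form an initial segment; this is a Galois
    connection with [changes g]. *)
Lemma change_pos_le g n i k : (k < n)%N ->
  (change_pos g n i <= k)%N = (i <= changes g k)%N.
Proof.
move=> kn; rewrite /change_pos; have [ik|ki] := leqP i (changes g k).
  apply: (@leq_trans (\sum_(j < n) (j < k))%N); last by rewrite sum_ltn geq_minl.
  apply: leq_sum => j _; have [_|kj] := ltnP j k; first by case: (changes _ _ < _)%N.
  by rewrite ltnNge (leq_trans ik)// changes_mono.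
apply/negbTE; rewrite -ltnNge; apply: (@leq_trans (\sum_(j < n) (j < k.+1))%N).
  by rewrite sum_ltn leq_min leqnn.
apply: leq_sum => j _; rewrite ltnS; have [jk|//] := leqP j k.
by rewrite (leq_ltn_trans (changes_mono g jk)).
Qed.

Lemma change_pos_breaks g n : (0 < n)%N ->
  breaks (fun i => (change_pos g n i)%:R / n%:R : R).
Proof.
move=> n0; have nR : 0 < n%:R :> R by rewrite ltr0n.
split.
- by rewrite /change_pos big1 ?mul0r// => k _; rewrite ltn0.
- move=> i _; rewrite ler_pM2r ?invr_gt0// ler_nat; apply: leq_sum => k _.
  by have [h|//] := ltnP (changes g k) i; rewrite leqW.
- rewrite ler_pdivrMr// mul1r ler_nat.
  apply: (@leq_trans (\sum_(k < n) 1)%N); last by rewrite sum_nat_const card_ord muln1.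
  by apply: leq_sum => k _; case: (changes _ _ < _)%N.
Qed.

(** The weights of index 0, ..., m add up to (-1)^m; having six weights covers m <= 5. *)
Lemma change_pos_step g n k : (k < n)%N -> (changes g n.-1 <= 5)%N ->
  (-1) ^+ g k = (-1) ^+ g 0%N * step R (change_pos g n) k.
Proof.
move=> kn g5; have : (changes g k <= 5)%N.
  by apply: leq_trans g5; apply: changes_mono; lia.
rewrite (odd_changes g k) signr_addb => ck; congr (_ * _).
rewrite /step; under eq_bigr do rewrite change_pos_le//.
rewrite !big_ord_recl big_ord0 /wt /= /bump /=.
by move: (changes g k) ck => [|[|[|[|[|[|x]]]]]] //= _; ring.
Qed.

(** An alternating sum over one block has modulus at most 1. The induction follows twice the sum
    minus its last term, a quantity that moves only at color changes, by 2. *)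
Lemma sum_sign_changes (g : nat -> bool) (m : nat) :
  `|\sum_(x < m.+1) (-1) ^+ x * (-1) ^+ g x| <= (changes g m).+1%:R :> R.
Proof.
have sq (b : nat) : (-1) ^+ b = 1 :> R \/ (-1) ^+ b = -1 :> R.
  by rewrite -(signr_odd R b); case: (odd b) => /=; [right; rewrite expr1|left; rewrite expr0].
suff : `|2 * (\sum_(x < m.+1) (-1) ^+ x * (-1) ^+ g x) - (-1) ^+ m * (-1) ^+ g m|
    <= 2 * (changes g m)%:R + 1 :> R.
  rewrite -natr1 !ler_norml => /andP[h1 h2].
  by case: (sq m) h1 h2 => ->; case: (sq (g m)) => -> h1 h2; apply/andP; split; lra.
elim: m => [|m IH].
  by rewrite big_ord_recl big_ord0 /changes big_ord0 /=; case: (g 0%N);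
    rewrite /= ler_norml; apply/andP; split; lra.
rewrite changesS natrD big_ord_recr /= mulrDr.
have eqn : 2 * (\sum_(i < m.+1) (-1) ^+ i * (-1) ^+ g i) + 2 * ((-1) ^+ m.+1 * (-1) ^+ g m.+1)
    - (-1) ^+ m.+1 * (-1) ^+ g m.+1 =
  2 * (\sum_(i < m.+1) (-1) ^+ i * (-1) ^+ g i) - (-1) ^+ m * (-1) ^+ g m
    + (-1) ^+ m * ((-1) ^+ g m - (-1) ^+ g m.+1) :> R by rewrite exprS; ring.
rewrite eqn; apply: le_trans (ler_normD _ _) _.
suff : `|(-1) ^+ m * ((-1) ^+ g m - (-1) ^+ g m.+1)| <= 2 * (g m != g m.+1)%:R :> R by lra.
by rewrite normrM; case: (sq m) => ->; rewrite ?normrN normr1 mul1r;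
  case: (g m); case: (g m.+1); rewrite /= ler_norml; apply/andP; split; lra.
Qed.

Lemma corner_abs (s u : R) : 0 <= s <= 1 -> 0 <= u <= 1 -> `|corner s u| <= 2.
Proof.
move=> /andP[s0 s1] /andP[u0 u1]; rewrite /corner.
have hb (x : R) : x <= 1 -> 0 <= hinge x ^+ 2 <= 1.
  move=> x1; rewrite sqr_ge0 /= expr_le1 ?hinge_ge0//.
  by case: hingeP => // _; exact: ler01.
have /andP[h1 h2] : 0 <= hinge (1 - u) ^+ 2 <= 1 by apply: hb; lra.
have /andP[h3 h4] : 0 <= hinge ((1 + s) / 2 - u) ^+ 2 <= 1 by apply: hb; lra.
have /andP[h5 h6] : 0 <= hinge ((1 - s) / 2 - u) ^+ 2 <= 1 by apply: hb; lra.
by rewrite ler_norml; apply/andP; split; lra.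
Qed.

Lemma energy_abs (t : nat -> R) : (forall i, (i < 6)%N -> 0 <= t i <= 1) ->
  `|energy t| <= 288.
Proof.
move=> t01; apply: le_trans (ler_norm_sum _ _ _) _.
have -> : 288 = \sum_(i < 6) 48 :> R by rewrite sumr_const card_ord -mulr_natr; ring.
apply: ler_sum => i _; apply: le_trans (ler_norm_sum _ _ _) _.
have -> : 48 = \sum_(i < 6) 8 :> R by rewrite sumr_const card_ord -mulr_natr; ring.
apply: ler_sum => j _; rewrite !normrM (_ : 8 = 2 * 2 * 2 :> R); last by ring.
by rewrite !ler_pM ?mulr_ge0 ?wt_abs ?corner_abs ?t01.
Qed.

End Approximation.

(** Only products of signs are compared with the step function, since swapping the two colors
    globally changes nothing. *)
Lemma mono_ratio_approx (R : realType) N (c : coloring N) (b : nat -> nat) :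
  (1 < N)%N -> c \in Ctilde2 N -> (forall i, (i < 6)%N -> (b i <= N./2)%N) ->
  (forall k l, (k < N./2)%N -> (l < N./2)%N ->
     sgn R c (N./2 + odd N + k) * sgn R c (N./2 + odd N + l) = step R b k * step R b l) ->
  `|mono_ratio R c - (1 + 2 * energy (fun i => (b i)%:R / N./2%:R)) / 4| <= 617 / N%:R.
Proof.
move=> N1 cC bn sb; have /andP[anti blocks12] : anti_symmetric c && (#|blocks c| <= 12)%N.
  by move: cC; rewrite inE.
have Ne := odd_double_half N; rewrite -addnn in Ne.
have n0 : (0 < N./2)%N by lia.
have e01 : odd N = false \/ odd N = true by case: (odd N); [right|left].
set n := N./2 in Ne n0 bn sb *; set E := energy _.
have nR : 0 < n%:R :> R by rewrite ltr0n.
have NR : N%:R = (odd N)%:R + (n%:R + n%:R) :> R by rewrite -!natrD Ne.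
have N0 : 1 <= N%:R :> R by rewrite ler1n; lia.
have hE : `|E| <= 288.
  apply: energy_abs => i i6; rewrite divr_ge0//= ler_pdivrMr// mul1r ler_nat; exact: bn.
have sg1 x : `|sgn R c x| = 1 by rewrite /sgn normrX normrN normr1 expr1n.
have sgL k : (k < n)%N -> sgn R c (n - k.+1) = - sgn R c (n + odd N + k).
  by move=> kn; rewrite /sgn (anti_symmetricP c anti)// signrN.
have sg_le1 x : (x < N)%N -> `|sgn R c x| <= 1 by rewrite sg1.
have hT := @pair_sum_fold R N (sgn R c) (fun k => sgn R c (n + odd N + k)) sg_le1
  (fun k _ => erefl) sgL.
have hS := step_sum_approx R n0 bn; rewrite -/E in hS.
rewrite -/n (eq_bigr (fun k : 'I_n => \sum_(l < n) step R b k * step R b l * kernel R n k l))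
  in hT; last by move=> k _; apply: eq_bigr => l _; rewrite sb.
have nsq (x : R) : x ^+ 2 = `|x| ^+ 2 by rewrite real_normK ?num_real.
(* The plain sum reduces to the middle sign and the alternating one is at most the number of blocks:
   (1 + 144)/2 <= 73. *)
have hX0 : 0 <= parity_sum N (sgn R c) <= 73.
  rewrite parity_sumE; apply/andP; split; first by rewrite divr_ge0// addr_ge0// sqr_ge0.
  have s1 : (\sum_(x < N) sgn R c x) ^+ 2 <= 1.
    rewrite (sum_halves N (sgn R c)) -/n big1 => [|k _]; last by rewrite sgL// addNr.
    by rewrite add0r exprMn (nsq (sgn _ _ _)) sg1 expr1n mulr1; case: (odd N); rewrite ?expr1n ?expr0n.
  have s2 : (\sum_(x < N) (-1) ^+ x * sgn R c x) ^+ 2 <= 12 ^+ 2.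
    rewrite nsq ler_sqr ?nnegrE//.
    have := sum_sign_changes R (col c) N.-1; rewrite prednK; last by lia.
    move=> /le_trans; apply; rewrite ler_nat.
    by move: blocks12; rewrite card_blocks//; lia.
  by lra.
have hA := card_ap3E R N; have := m3_sum R c.
rewrite /mono_ratio; set A := #|ap3 N|%:R in hA *; set M := (m3 c)%:R.
set T := pair_sum _ _ in hT *; set X := parity_sum _ _ in hX0 *.
set S := \sum_(k < n) _ in hS hT => hM.
have A0 : N%:R ^+ 2 / 2 <= A by rewrite hA; case: e01 => -> /=; lra.
have N2 : 0 < N%:R ^+ 2 :> R by rewrite exprn_gt0//; lra.
have Apos : 0 < A by lra.
have -> : M / A - (1 + 2 * E) / 4 = (2 * T + X - 2 * (A * E)) / (4 * A).
  have -> : M = (A + 2 * T + X) / 4 by lra.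
  by field; exact: lt0r_neq0.
rewrite normrM normfV (@gtr0_norm _ (4 * A)); last by lra.
rewrite ler_pdivrMr; last by lra.
(* 1233 = 8 + 576 + 576 + 73, for the folding, the lattice sums, the replacement of 2A by 4 n^2, and
   X. Dividing by 4A >= 2 N^2 leaves less than 617/N. *)
apply: (@le_trans _ _ (1233 * N%:R)); last first.
  rewrite mulrAC ler_pdivlMr; last by lra.
  by rewrite -mulrA -expr2; lra.
have hA2 : A * 2 = n%:R ^+ 2 * 4 + (odd N)%:R * 2 * N%:R.
  by rewrite hA NR; case: e01 => -> /=; field.
have hAE : `|A * 2 * E - n%:R ^+ 2 * 4 * E| <= 576 * N%:R.
  rewrite -mulrBl hA2 addrAC subrr add0r !normrM !normr_nat.
  have -> : 576 * N%:R = 1 * 2 * N%:R * 288 :> R by ring.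
  by rewrite !ler_pM ?mulr_ge0//; case: e01 => -> /=; rewrite ?ler01.
move: hT hS hX0 hAE; rewrite !ler_norml => /andP[? ?] /andP[? ?] /andP[? ?] /andP[? ?].
have nN : n%:R * 2 <= N%:R :> R by rewrite NR; case: e01 => -> /=; lra.
by apply/andP; split; lra.
Qed.

Lemma mono_ratio_lower (R : realType) N (c : coloring N) : (1 < N)%N ->
  c \in Ctilde2 N -> 117 / 548 - 617 / N%:R <= mono_ratio R c.
Proof.
move=> N1 cC; have Ne := odd_double_half N; rewrite -addnn in Ne.
have n0 : (0 < N./2)%N by lia.
pose g k := col c (N./2 + odd N + k).
have g5 : (changes g N./2.-1 <= 5)%N.
  by rewrite -Ctilde2P//; move: cC; rewrite inE => /andP[].
have bb := change_pos_breaks R g n0.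
have bn i : (i < 6)%N -> (change_pos g N./2 i <= N./2)%N.
  move=> i6; have := breaks_le1 bb i6.
  by rewrite ler_pdivrMr ?ltr0n// mul1r ler_nat.
have := @mono_ratio_approx R N c (change_pos g N./2) N1 cC bn.
have := energy_ge bb; set E := energy _ => hE /(_ _)/wrap[k l kn ln|].
  rewrite /sgn -/(g k) -/(g l) (change_pos_step R kn g5) (change_pos_step R ln g5).
  by rewrite mulrACA -expr2 sqrr_sign mul1r.
by rewrite ler_norml => /andP[? _]; lra.
Qed.

(* The optimal breakpoints, in units of 1/274. *)
Definition opt_num (i : nat) : nat := nth 0%N [:: 0; 116; 175; 212; 240; 246]%N i.

Definition opt_pos (n i : nat) : nat := ((opt_num i * n) %/ 274)%N.

Definition opt_half (n k : nat) : bool := odd (\sum_(i < 5) (opt_pos n i.+1 <= k))%N.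

(** For odd N the middle element falls into the second branch, where truncated subtraction gives it
    the value of [opt_half] at 0. *)
Definition opt_coloring (N : nat) : coloring N :=
  [ffun i : 'I_N => if (i < N./2)%N then ~~ opt_half N./2 (N./2 - i.+1)
                    else opt_half N./2 (i - (N./2 + odd N))].

(* Energy and membership of the optimal coloring *)
Delimit Scope Z_scope with coqZ.

(** [corner] at multiples of 1/274, scaled by 548^2. The denominator 548 absorbs the halves, so the
    energy is evaluated in integers. *)
Definition cornerZ (x y : Z) : Z :=
  let sq z := Z.mul (Z.max Z0 z) (Z.max Z0 z) in
  (sq (548 - 2 * y) - sq (274 + x - 2 * y) - sq (274 - x - 2 * y))%coqZ.

Lemma hinge_zR (R : realFieldType) (z : Z) (d : R) : 0 <= d ->
  hinge (zR R z / d) = zR R (Z.max Z0 z) / d.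
Proof.
move=> d0; case: z => [|p|p]; first by rewrite zR0 mul0r hinge_eq0.
  by rewrite hinge_id//; apply: divr_ge0 => //; exact: zR_ge0.
by rewrite [zR R (Z.max _ _)]zR0 mul0r hinge_eq0// zR_neg mulNr oppr_le0 divr_ge0.
Qed.

Lemma corner_zR (R : realFieldType) (x y : Z) :
  corner (zR R x / 274) (zR R y / 274) = zR R (cornerZ x y) / 548 ^+ 2.
Proof.
have zB a b : zR R (Z.sub a b) = zR R a - zR R b.
  by rewrite -Z.add_opp_r zRD; congr (_ + _); case: b => [|p|p]; rewrite ?zR_neg ?opprK// zR0 oppr0.
have [z2 z274 z548] : [/\ zR R (Zpos 2) = 2, zR R (Zpos 274) = 274 & zR R (Zpos 548) = 548] by [].
rewrite /corner.
have -> : 1 - zR R y / 274 = zR R (548 - 2 * y)%coqZ / 548.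
  by rewrite zB zRM z2 z548; field.
have -> : (1 + zR R x / 274) / 2 - zR R y / 274 = zR R (274 + x - 2 * y)%coqZ / 548.
  by rewrite zB zRD zRM z2 z274; field.
have -> : (1 - zR R x / 274) / 2 - zR R y / 274 = zR R (274 - x - 2 * y)%coqZ / 548.
  by rewrite !zB zRM z2 z274; field.
have d0 : 0 <= 548 :> R := ler0n _ _.
by rewrite !(hinge_zR _ d0) /cornerZ !zB !zRM; field.
Qed.

Lemma opt_energy (R : realType) : energy (fun i => (opt_num i)%:R / 274 : R) = - (10 / 137).
Proof.
pose m i : Z := Z.of_nat (opt_num i).
pose w (i : nat) : Z := nth Z0 [:: 1; -2; 2; -2; 2; -2]%coqZ i.
have mE i : (opt_num i)%:R = zR R (m i).
  rewrite /m; case: (opt_num i) => [//|k].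
  by rewrite -[Z.of_nat k.+1]/(Zpos (Pos.of_succ_nat k)) zR_pos Pnat.SuccNat2Pos.id_succ.
have wE (i : 'I_6) : wt R i = zR R (w i).
  have n2 : Pos.to_nat 2 = 2%N by [].
  case: i => -[|[|[|[|[|[|i]]]]]] i6 //; rewrite /w /wt /= ?zR_neg ?zR_pos ?n2; ring.
have -> : energy (fun i => (opt_num i)%:R / 274 : R) =
    zR R (\big[Z.add/Z0]_(i < 6) \big[Z.add/Z0]_(j < 6)
      Z.mul (Z.mul (w i) (w j)) (cornerZ (m i) (m j))) / 548 ^+ 2.
  rewrite (big_morph _ (zRD R) (zR0 R)) mulr_suml; apply: eq_bigr => i _.
  rewrite (big_morph _ (zRD R) (zR0 R)) mulr_suml; apply: eq_bigr => j _.
  by rewrite !mE corner_zR !wE !zRM mulrA.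
(* As 548^2 = 16 * 137^2, this integer corresponds to -10/137. *)
have -> : \big[Z.add/Z0]_(i < 6) \big[Z.add/Z0]_(j < 6)
      Z.mul (Z.mul (w i) (w j)) (cornerZ (m i) (m j)) = (-10 * (16 * 137))%coqZ.
  by rewrite !big_ord_recl !big_ord0; vm_compute.
rewrite !zRM zR_neg !zR_pos.
have [-> -> ->] : [/\ Pos.to_nat 10 = 10%N, Pos.to_nat 16 = 16%N & Pos.to_nat 137 = 137%N].
  by split; lia.
by field.
Qed.

Lemma opt_pos_le n i : (opt_pos n i <= n)%N.
Proof.
have h : (opt_num i <= 274)%N by move: i => [|[|[|[|[|[|[|i]]]]]]].
rewrite /opt_pos -[leqRHS](mulnK n (isT : (0 < 274)%N)) leq_div2r// mulnC.
by rewrite leq_mul2l h orbT.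
Qed.

Lemma opt_pos_mono n i : (i < 5)%N -> (opt_pos n i <= opt_pos n i.+1)%N.
Proof.
move=> i5; rewrite /opt_pos leq_div2r// leq_mul2r; apply/orP; right.
by move: i i5 => [|[|[|[|[|i]]]]].
Qed.

Lemma opt_half_step (R : realFieldType) n k : (-1) ^+ opt_half n k = step R (opt_pos n) k.
Proof.
have m i (i5 : (i < 5)%N) : (opt_pos n i.+1 <= k)%N -> (opt_pos n i <= k)%N.
  exact: leq_trans (opt_pos_mono n i5).
have := m 4%N isT; have := m 3%N isT; have := m 2%N isT; have := m 1%N isT.
rewrite /opt_half signr_odd /step !big_ord_recl !big_ord0 /wt /= /bump /=.
rewrite !addn0 !add1n.
case: (opt_pos n 1 <= k)%N; case: (opt_pos n 2 <= k)%N; case: (opt_pos n 3 <= k)%N;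
  case: (opt_pos n 4 <= k)%N; case: (opt_pos n 5 <= k)%N => /= h1 h2 h3 h4;
  by [ring|have := h1 isT|have := h2 isT|have := h3 isT|have := h4 isT].
Qed.

Lemma changes_opt_half n x : (changes (opt_half n) x <= 5)%N.
Proof.
pose cnt k := (\sum_(i < 5) (opt_pos n i.+1 <= k))%N.
have cnt_mono k : (cnt k <= cnt k.+1)%N.
  apply: leq_sum => i _; have [h|//] := leqP (opt_pos n i.+1) k.
  by rewrite (leq_trans h).
apply: (@leq_trans (cnt x)).
  elim: x => [|x IH]; first by rewrite /changes big_ord0.
  rewrite changesS; have [|lt] := eqVneq (cnt x) (cnt x.+1).
    by rewrite /opt_half -!/(cnt _) => <-; rewrite eqxx addn0.
  apply: (@leq_trans (cnt x).+1); first by case: (_ != _) => /=; lia.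
  by rewrite ltn_neqAle lt cnt_mono.
apply: (@leq_trans (\sum_(i < 5) 1)%N); last by rewrite sum_nat_const card_ord.
by apply: leq_sum => i _; exact: leq_b1.
Qed.

Lemma col_opt_coloring_right N k : (k < N./2)%N ->
  col (opt_coloring N) (N./2 + odd N + k) = opt_half N./2 k.
Proof.
move=> kn; have Ne := odd_double_half N; rewrite -addnn in Ne.
have xN : (N./2 + odd N + k < N)%N by lia.
rewrite (colE _ (Ordinal xN)) ffunE /= (_ : (_ < N./2)%N = false); last by lia.
by congr opt_half; lia.
Qed.

Lemma col_opt_coloring_left N k : (k < N./2)%N ->
  col (opt_coloring N) (N./2 - k.+1) = ~~ opt_half N./2 k.
Proof.
move=> kn; have Ne := odd_double_half N; rewrite -addnn in Ne.
have xN : (N./2 - k.+1 < N)%N by lia.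
rewrite (colE _ (Ordinal xN)) ffunE /= (_ : (_ < N./2)%N = true); last by lia.
by congr (~~ opt_half _ _); lia.
Qed.

Lemma opt_coloring_Ctilde2 N : (1 < N)%N -> opt_coloring N \in Ctilde2 N.
Proof.
move=> N1; rewrite Ctilde2P//; last first.
  apply/anti_symmetricP => k kn.
  by rewrite col_opt_coloring_right// col_opt_coloring_left.
apply: leq_trans (changes_opt_half N./2 N./2.-1); rewrite eq_leq//.
have Ne := odd_double_half N; rewrite -addnn in Ne.
by apply: eq_bigr => i _; rewrite !col_opt_coloring_right//; have := ltn_ord i; lia.
Qed.

Lemma mono_ratio_upper (R : realType) N : (1 < N)%N ->
  mono_ratio R (opt_coloring N) <=
  (1 + 2 * energy (fun i => (opt_pos N./2 i)%:R / N./2%:R : R)) / 4 + 617 / N%:R.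
Proof.
move=> N1; have H k l : (k < N./2)%N -> (l < N./2)%N ->
    sgn R (opt_coloring N) (N./2 + odd N + k) * sgn R (opt_coloring N) (N./2 + odd N + l)
    = step R (opt_pos N./2) k * step R (opt_pos N./2) l.
  by move=> kn ln; rewrite /sgn !col_opt_coloring_right// !opt_half_step.
have := mono_ratio_approx N1 (opt_coloring_Ctilde2 N1) (fun i _ => opt_pos_le N./2 i) H.
by rewrite ler_norml => /andP[_ ?]; lra.
Qed.

Lemma opt_pos_cvg (R : realType) i :
  (opt_pos N./2 i)%:R / N./2%:R @[N --> \oo] --> ((opt_num i)%:R / 274 : R).
Proof.
(* Rounding down costs at most 1/n with n = [N./2], and N + 1 <= 4n once N > 2; [harmonic N] is 1/(N
   + 1). *)
have h4 : 4 * harmonic N @[N --> \oo] --> (0 : R).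
  by rewrite -(mulr0 4); apply: cvgMl_tmp; exact: cvg_harmonic.
apply: (@squeeze_cvgr _ _ _ _ (fun N => (opt_num i)%:R / 274 - 4 * harmonic N)
  (fun=> (opt_num i)%:R / 274)); last 2 first.
- by rewrite -[X in _ --> X]subr0; apply: cvgB => //; exact: cvg_cst.
- exact: cvg_cst.
near=> N; have N3 : (2 < N)%N by near: N; exists 3%N.
have Ne := odd_double_half N; rewrite -addnn in Ne.
have n0 : (0 < N./2)%N by lia.
have nR : 0 < N./2%:R :> R by rewrite ltr0n.
have /eqP := divn_eq (opt_num i * N./2)%N 274; rewrite -/(opt_pos _ _).
rewrite -(eqr_nat R) natrD !natrM => /eqP dE.
have r0 : 0 <= ((opt_num i * N./2) %% 274)%N%:R :> R by [].
have r1 : ((opt_num i * N./2) %% 274)%N%:R <= 274 :> R.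
  by rewrite ler_nat ltnW// ltn_mod.
apply/andP; split.
  rewrite ler_pdivlMr// mulrBl /harmonic /=.
  have : 1 <= 4 * N.+1%:R^-1 * N./2%:R :> R.
    rewrite -mulrA mulrCA -ler_pdivrMl ?invr_gt0 ?ltr0n// invrK mulr1 -natrM ler_nat.
    by lia.
  move: r1; rewrite [(opt_num i)%:R / 274 * _]mulrAC dE; move: (4 / _ * _) (opt_pos _ _)%:R (_ %% _)%:R.
  by move=> u p r; lra.
rewrite ler_pdivrMr// mulrAC dE; move: r0; move: (opt_pos _ _)%:R (_ %% _)%:R.
by move=> p r; lra.
Unshelve. all: by end_near. Qed.

Theorem theorem1p2 (R : realType) :
  (fun N : nat => Ptilde R N) @ \oo --> (117%:R / 548%:R : R).
Proof.
have h0 : 1234 * harmonic N @[N --> \oo] --> (0 : R).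
  by rewrite -(mulr0 1234); apply: cvgMl_tmp; exact: cvg_harmonic.
(* The factor 2 comes from N + 1 <= 2N. *)
have hN N : (0 < N)%N -> 617 / N%:R <= 1234 * harmonic N :> R.
  move=> N0; rewrite /harmonic /= ler_pdivrMr ?ltr0n// mulrAC ler_pdivlMr ?ltr0n//.
  by rewrite -!natrM ler_nat; lia.
have lim : (1 + 2 * energy (fun i => (opt_pos N./2 i)%:R / N./2%:R : R)) / 4 + 1234 * harmonic N
    @[N --> \oo] --> (117 / 548 : R).
  have -> : 117 / 548 = (1 + 2 * - (10 / 137)) / 4 + 0 :> R by field.
  rewrite -(opt_energy R); apply: cvgD => //; apply: cvgMr_tmp; apply: cvgD; first exact: cvg_cst.
  by apply: cvgMl_tmp; apply: energy_cvg => i _; exact: opt_pos_cvg.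
apply: (@squeeze_cvgr _ _ _ _ (fun N => 117 / 548 - 1234 * harmonic N)
  (fun N => (1 + 2 * energy (fun i => (opt_pos N./2 i)%:R / N./2%:R : R)) / 4
     + 1234 * harmonic N)) => //; last first.
  by rewrite -[X in _ --> X]subr0; apply: cvgB => //; exact: cvg_cst.
near=> N; have N1 : (1 < N)%N by near: N; exists 2%N.
have hN' := hN N (ltnW N1); have [[c cC PE] Pmin] := Ptilde_is_min R N.
apply/andP; split.
  by rewrite PE; have := mono_ratio_lower R N1 cC; lra.
by have := Pmin _ (opt_coloring_Ctilde2 N1); have := mono_ratio_upper R N1; lra.
Unshelve. all: by end_near. Qed.
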